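(* Clique-Identification and Cluster-Identification each admit a kernel with $\mathcal{O}(p^4)$ vertices when parameterized by $p=n-k$, where $n$ is the number of vertices of the input graph and $k$ the input integer.
   Context: All graphs are finite, simple and undirected. An identification of two distinct vertices $u,v$ replaces them with a new vertex adjacent to every vertex of $(N(u)\cup N(v))\setminus\{u,v\}$. A cluster graph is a graph every connected component of which is a complete graph. Clique-Identification (resp. Cluster-Identification) takes as input a graph $G$ and an integer $k\ge 0$ and asks whether $G$ can be transformed into a complete graph (resp. a cluster graph) by at most $k$ identifications. A kernel for parameter $p$ is a polynomial-time algorithm mapping each instance to an equivalent instance of the same problem whose number of vertices and whose parameter value are bounded by a function of $p$. *)

(* Defs.v *)
From mathcomp Require Import all_boot all_order all_algebra.

Set Implicit Arguments.
Unset Strict Implicit.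
Unset Printing Implicit Defensive.

(** * Graphs and identifications *)

Record sgraph (V : finType) := SGraph {
  adj :> rel V;
  adj_sym : symmetric adj;
  adj_irr : irreflexive adj
}.

Section Identification.

Variables (V : finType) (G : sgraph V) (u v : V).

(* [None] is the new vertex, [Some x] an old vertex other than [u] and [v]. *)
Definition ident_vertex : finType := option {x : V | (x != u) && (x != v)}.

Definition ident_rel (a b : ident_vertex) : bool :=
  match a, b with
  | Some x, Some y => adj G (val x) (val y)
  | Some x, None | None, Some x => adj G u (val x) || adj G v (val x)
  | None, None => false
  end.

Lemma ident_sym : symmetric ident_rel.
Proof. by case=> [x|] [y|] //=; rewrite adj_sym. Qed.

Lemma ident_irr : irreflexive ident_rel.
Proof. by case=> [x|] //=; rewrite adj_irr. Qed.

Definition ident : sgraph ident_vertex := SGraph ident_sym ident_irr.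

End Identification.

Definition graph_class := forall V : finType, sgraph V -> Prop.

(* [G] can be turned into a member of [P] by at most [k] identifications. *)
Fixpoint identifiable (P : graph_class) (k : nat) (V : finType) (G : sgraph V)
    {struct k} : Prop :=
  P V G \/
  match k with
  | 0 => False
  | j.+1 => exists u v : V, u != v /\ identifiable P j (ident G u v)
  end.

Definition complete_graph : graph_class :=
  fun V G => forall u v : V, u != v -> adj G u v.

Definition cluster_graph : graph_class :=
  fun V G => forall x u v : V,
    connect (adj G) x u -> connect (adj G) x v -> u != v -> adj G u v.

(** * Problem instances *)

Record instance := Instance {
  order : nat;
  graph : sgraph 'I_order;
  budget : nat
}.

Definition clique_identification (x : instance) : Prop :=
  identifiable complete_graph (budget x) (graph x).

Definition cluster_identification (x : instance) : Prop :=
  identifiable cluster_graph (budget x) (graph x).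

(* An integer, since the budget may exceed the number of vertices. *)
Definition order_minus_budget (x : instance) : int :=
  ((order x)%:Z - (budget x)%:Z)%R.

(* The number of vertices, the budget, and the adjacency matrix by rows. *)
Definition encode (x : instance) : seq nat :=
  [:: order x, budget x &
      [seq (adj (graph x) u v : nat) | u <- enum 'I_(order x),
                                       v <- enum 'I_(order x)]].

(** * Polynomial time *)

(* Random access machine over the natural numbers, with structured control
   flow, at unit cost. The arithmetic is addition and truncated subtraction
   only: one step lengthens the longest number by at most one bit, so that
   polynomial time is the same here as on Turing machines (this would fail with
   unit-cost multiplication). *)
Inductive ram :=
  | Const of nat & nat         (* r_i := n *)
  | Add of nat & nat & nat     (* r_i := r_j + r_k *)
  | Sub of nat & nat & nat     (* r_i := r_j - r_k *)
  | Read of nat & nat          (* r_i := mem[r_j] *)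
  | Write of nat & nat         (* mem[r_i] := r_j *)
  | Skip
  | Seq of ram & ram
  | If of nat & ram & ram      (* first branch when r_i is nonzero *)
  | While of nat & ram.        (* loop as long as r_i is nonzero *)

Record ram_state := RamState { reg : nat -> nat; mem : nat -> nat }.

Definition upd (f : nat -> nat) (i a : nat) : nat -> nat :=
  fun j => if j == i then a else f j.

Definition set_reg (s : ram_state) (i a : nat) : ram_state :=
  RamState (upd (reg s) i a) (mem s).

Definition set_mem (s : ram_state) (i a : nat) : ram_state :=
  RamState (reg s) (upd (mem s) i a).

(* [ram_exec c s t s']: started in [s], [c] halts in [s'] after [t] steps. *)
Inductive ram_exec : ram -> ram_state -> nat -> ram_state -> Prop :=
  | ExecConst i n s : ram_exec (Const i n) s 1 (set_reg s i n)
  | ExecAdd i j k s :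
      ram_exec (Add i j k) s 1 (set_reg s i (reg s j + reg s k))
  | ExecSub i j k s :
      ram_exec (Sub i j k) s 1 (set_reg s i (reg s j - reg s k))
  | ExecRead i j s : ram_exec (Read i j) s 1 (set_reg s i (mem s (reg s j)))
  | ExecWrite i j s : ram_exec (Write i j) s 1 (set_mem s (reg s i) (reg s j))
  | ExecSkip s : ram_exec Skip s 1 s
  | ExecSeq c1 c2 s1 s2 s3 t1 t2 :
      ram_exec c1 s1 t1 s2 -> ram_exec c2 s2 t2 s3 ->
      ram_exec (Seq c1 c2) s1 (t1 + t2) s3
  | ExecIfTrue i c1 c2 s s' t :
      reg s i != 0 -> ram_exec c1 s t s' -> ram_exec (If i c1 c2) s t.+1 s'
  | ExecIfFalse i c1 c2 s s' t :
      reg s i = 0 -> ram_exec c2 s t s' -> ram_exec (If i c1 c2) s t.+1 s'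
  | ExecWhileStop i c s : reg s i = 0 -> ram_exec (While i c) s 1 s
  | ExecWhileStep i c s1 s2 s3 t1 t2 :
      reg s1 i != 0 -> ram_exec c s1 t1 s2 -> ram_exec (While i c) s2 t2 s3 ->
      ram_exec (While i c) s1 (t1 + t2).+1 s3.

(* A word [w] is read and written in the memory cells [0], ..., [size w - 1],
   its length in register [0]; everything else is initially zero. *)
Definition ram_input (w : seq nat) : ram_state :=
  RamState (upd (fun _ => 0) 0 (size w)) (nth 0 w).

Definition ram_output (s : ram_state) (w : seq nat) : Prop :=
  reg s 0 = size w /\ forall i, i < size w -> mem s i = nth 0 w i.

(* Total number of binary digits. *)
Definition bit_size (w : seq nat) : nat :=
  \sum_(a <- w) (trunc_log 2 a).+1.

Definition poly_time (f : instance -> instance) : Prop :=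
  exists (c : ram) (a d : nat), forall x : instance,
    exists (t : nat) (s : ram_state),
      [/\ ram_exec c (ram_input (encode x)) t s,
          ram_output s (encode (f x))
        & t <= a * bit_size (encode x) ^ d].

(** * Kernels *)

(* A kernel with O(h(p)) vertices for the parameter [p = par x]. The successor
   in the vertex bound only matters when [h `|par x|] is zero, where it allows
   constant size. *)
Definition admits_kernel (L : instance -> Prop) (par : instance -> int)
    (h : nat -> nat) : Prop :=
  exists f : instance -> instance,
    [/\ poly_time f,
        forall x, L x <-> L (f x),
        exists c : nat, forall x, order (f x) <= c * (h `|par x|%N).+1
      & exists g : int -> nat, forall x, `|par (f x)|%N <= g (par x)].

(* Main.v *)
From mathcomp Require Import all_boot all_order all_algebra zify.
Require Import Defs.

Set Implicit Arguments.
Unset Strict Implicit.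
Unset Printing Implicit Defensive.

(** Put p = n - k. Up to k identifications reach a complete (cluster) graph iff the
    vertices can be partitioned into exactly p parts such that any two parts
    (any two parts of the same component of the quotient) are joined by an edge.
    Only O(p^2) edges witness such a partition.

    Greedily choose a subgraph H of maximum degree at most D = 4p^2, stopping at
    16p^4 arcs. If H reaches that size, its edges realize all pairs of p parts, and
    the instance is positive. Otherwise every edge outside H has an endpoint of degree
    D in H, so each witness edge can be rerouted to a fresh H-neighbour of that
    endpoint, within the same component: solutions only need the edges of H. Hence
    every vertex outside H can be merged into a neighbour, which changes neither the
    components nor H. For cluster graphs, p isolated vertices already give a solution,
    so only the first p of them are kept. One map serves both problems. It is computed
    by a program over n x n tables whose loops all run over the vertices, which makes
    its running time polynomial by construction. *)

(** * Identification sequences as vertex partitions *)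

Definition target (b : bool) : graph_class :=
  if b then complete_graph else cluster_graph.

(* The parts are the elements of [W]; [r] relates two parts when they lie in the
   same component of the target, so [b] forces a single component. *)
Record cluster_map (b : bool) (V W : finType) (G : sgraph V) (f : V -> W)
    (r : rel W) : Prop := ClusterMap {
  cm_equiv : equivalence_rel r;
  cm_total : b -> forall c c', r c c';
  cm_adj : forall x y, adj G x y -> r (f x) (f y);
  cm_surj : forall c, exists x, f x = c;
  cm_edge : forall c c', c != c' -> r c c' ->
    exists x y, [/\ adj G x y, f x = c & f y = c']
}.

Section ClusterMap.

Variables (b : bool) (V W : finType) (G : sgraph V) (f : V -> W) (r : rel W).
Hypothesis cm : cluster_map b G f r.

Lemma cm_refl c : r c c.
Proof. by have [] := cm_equiv cm c c c. Qed.

Lemma cm_ltrans c c' : r c c' -> r c =1 r c'.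
Proof. by move=> h z; have [_ ->] := cm_equiv cm c c' z. Qed.

Lemma cm_sym c c' : r c c' = r c' c.
Proof.
by apply/idP/idP => h; [rewrite -(cm_ltrans h) | rewrite -(cm_ltrans h)];
  apply: cm_refl.
Qed.

Lemma cm_trans c' c c'' : r c c' -> r c' c'' -> r c c''.
Proof. by move=> /cm_ltrans ->. Qed.

Lemma cm_connect x y : connect (adj G) x y -> r (f x) (f y).
Proof.
move=> /connectP[s + ->]; elim: s x => [|z s IH] x /=; first by rewrite cm_refl.
by move=> /andP[/(cm_adj cm) xz /IH]; apply: cm_trans xz.
Qed.

(** With singleton parts, the edges given by [cm_edge] join the vertices themselves, and
    [cm_connect] puts connected vertices into related parts. *)
Lemma cm_injective : injective f -> target b G.
Proof.
move=> fi; have edge u v : u != v -> r (f u) (f v) -> adj G u v.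
  move=> uv ruv; have [|x [y [xy /fi <- /fi <- //]]] := cm_edge cm _ ruv.
  by rewrite inj_eq.
rewrite /target; have := cm_total cm; case: (b) => [tot u v uv|_ x u v xu xv uv];
  apply: edge => //; first exact: tot.
by apply: cm_trans (cm_connect xv); rewrite cm_sym; apply: cm_connect.
Qed.

End ClusterMap.

Lemma target_cluster_map b (V : finType) (G : sgraph V) :
  target b G -> exists r, cluster_map b G id r.
Proof.
rewrite /target; case: b => [cG|cG].
  exists (fun _ _ => true); split=> // [c|c c' cc' _]; first by exists c.
  by exists c, c'; split=> //; apply: cG.
have sG : connect_sym (adj G) by apply: sym_connect_sym; apply: adj_sym.
exists (connect (adj G)); split=> //.
- by apply/equivalence_relP; split; [exact: connect0 | move=> x y /(same_connect sG)].
- by move=> x y; apply: connect1.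
- by move=> c; exists c.
- move=> c c' cc' h; exists c, c'; split=> //.
  by apply: (cG c) => //; apply: connect0.
Qed.

Section IdentProjection.

Variables (V : finType) (G : sgraph V) (u v : V).

(** [insub] fails exactly on [u] and [v], which therefore go to the new vertex [None]. *)
Definition ident_proj (x : V) : ident_vertex u v := insub x.

Lemma ident_proj_None x : (ident_proj x == None) = (x == u) || (x == v).
Proof.
rewrite /ident_proj; case: insubP => [z|] /=.
  by move=> /andP[/negbTE-> /negbTE->].
by rewrite negb_and !negbK => ->.
Qed.

Lemma ident_proj_adj x y :
  adj G x y -> ident_proj x = ident_proj y \/ ident G u v (ident_proj x) (ident_proj y).
Proof.
rewrite /ident_proj; case: insubP => [z _ zx|]; case: insubP => [w _ wy|] //=.
- by rewrite zx wy => ->; right.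
- rewrite negb_and !negbK zx => /orP[]/eqP e xy; right;
    by rewrite -e (adj_sym G y) xy ?orbT.
- by rewrite negb_and !negbK wy => /orP[]/eqP e xy; right; rewrite -e xy ?orbT.
- by left.
Qed.

Lemma ident_proj_edge a c : ident G u v a c ->
  exists x y, [/\ adj G x y, ident_proj x = a & ident_proj y = c].
Proof.
have pS (z : {x : V | (x != u) && (x != v)}) : ident_proj (val z) = Some z.
  by rewrite /ident_proj valK.
have pu : ident_proj u = None by apply/eqP; rewrite ident_proj_None eqxx.
have pv : ident_proj v = None by apply/eqP; rewrite ident_proj_None eqxx orbT.
case: a c => [z|] [w|] //=.
- by move=> zw; exists (val z), (val w).
- by case/orP => h; [exists (val z), u|exists (val z), v]; split=> //; rewrite adj_sym.
- by case/orP => h; [exists u, (val w)|exists v, (val w)].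
Qed.

Lemma ident_proj_surj a : exists x, ident_proj x = a.
Proof.
case: a => [z|]; first by exists (val z); rewrite /ident_proj valK.
by exists u; apply/eqP; rewrite ident_proj_None eqxx.
Qed.

Lemma card_ident : u != v -> #|ident_vertex u v|.+1 = #|V|.
Proof.
move=> uv; rewrite card_option card_sig.
have -> : #|[pred x | (x != u) && (x != v)]| = #|~: [set u; v]|.
  by apply: eq_card => x; rewrite !inE negb_or.
by rewrite -(cardsC [set u; v]) cards2 uv.
Qed.

End IdentProjection.

(** Each identification removes one vertex, so [k] of them leave at least [#|V| - k] parts;
    partitions are pulled back along [ident_proj]. *)
Lemma identifiable_cluster_map b k (V : finType) (G : sgraph V) :
  identifiable (target b) k G ->
  exists (W : finType) (f : V -> W) r, cluster_map b G f r /\ #|V| <= #|W| + k.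
Proof.
elim: k V G => [|k IH] V G /= [tG|].
- by have [r cm] := target_cluster_map tG; exists V, id, r; rewrite addn0.
- by [].
- by have [r cm] := target_cluster_map tG; exists V, id, r; rewrite leq_addr.
move=> [u [v [uv /IH[W [f [r [cm le]]]]]]].
exists W, (f \o ident_proj u v), r; split; last by rewrite -(card_ident uv) addnS ltnS.
split.
- exact: cm_equiv cm.
- exact: cm_total cm.
- move=> x y /(@ident_proj_adj _ _ u v)[/= ->|]; first exact: cm_refl cm _.
  by move=> /(cm_adj cm).
- move=> c; have [a <-] := cm_surj cm c; have [x <-] := ident_proj_surj a.
  by exists x.
- move=> c c' cc' rcc'; have [a [a' [aa' <- <-]]] := cm_edge cm cc' rcc'.
  by have [x [y [xy <- <-]]] := ident_proj_edge aa'; exists x, y.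
Qed.

(** Two vertices of the same part are identified, adjacent or not, and [f] factors through the
    result. Once the budget is spent, counting forces the surjection [f] to be injective. *)
Lemma cluster_map_identifiable b k (V W : finType) (G : sgraph V) (f : V -> W) r :
  cluster_map b G f r -> #|V| <= #|W| + k -> identifiable (target b) k G.
Proof.
elim: k V G f => [|k IH] V G f cm le.
  left; apply: (cm_injective cm).
  have h : #|W| <= #|codom f|.
    by apply/subset_leq_card/subsetP => c _; have [x <-] := cm_surj cm c; apply: codom_f.
  suff /image_injP inj : #|codom f| == #|V| by move=> x y; apply: inj.
  by rewrite eqn_leq leq_image_card /= (leq_trans le) // addn0.
have [fi|/injectivePn[u [v uv fuv]]] := altP (injectiveP f).
  by left; apply: cm_injective cm fi.
right; exists u, v; split=> //.
pose g (a : ident_vertex u v) := if a is Some x then f (val x) else f u.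
have gp x : g (ident_proj u v x) = f x.
  rewrite /ident_proj; case: insubP => [z _ <- //|].
  by rewrite negb_and !negbK => /orP[]/eqP->.
apply: (IH _ _ g); last by rewrite -(card_ident uv) addnS ltnS in le.
split.
- exact: cm_equiv cm.
- exact: cm_total cm.
- by move=> a c /ident_proj_edge[x [y [xy <- <-]]]; rewrite !gp; apply: cm_adj cm _ _ xy.
- by move=> c; have [x <-] := cm_surj cm c; exists (ident_proj u v x).
- move=> c c' cc' rcc'; have [x [y [xy ex ey]]] := cm_edge cm cc' rcc'.
  exists (ident_proj u v x), (ident_proj u v y); rewrite !gp; split=> //.
  have [e|//] := ident_proj_adj u v xy.
  by rewrite -ex -ey -!gp e eqxx in cc'.
Qed.

Definition solvable_with (b : bool) (p : nat) (V : finType) (G : sgraph V) : Prop :=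
  exists (f : V -> 'I_p) r, cluster_map b G f r.

(* Parts outside the chosen [p] ones are merged into a chosen part of their own
   component if there is one, and into a fixed chosen part otherwise. *)
Lemma cluster_map_shrink b (V W : finType) (G : sgraph V) (f : V -> W) r p :
  cluster_map b G f r -> 0 < p <= #|W| -> solvable_with b p G.
Proof.
move=> cm; case: p => // p /= le.
pose io (i : 'I_p.+1) : W := enum_val (widen_ord le i).
have io_inj : injective io.
  by move=> i j /enum_val_inj/(congr1 val) /= e; apply: val_inj.
pose rho c := if [pick i | io i == c] is Some i then i else
  if [pick i | r c (io i)] is Some i then i else ord0.
have rhoK i : rho (io i) = i.
  rewrite /rho; case: pickP => [j /eqP/io_inj //|/(_ i)]; by rewrite eqxx.
have rho_in c i : r c (io i) -> r c (io (rho c)).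
  rewrite /rho; case: pickP => [j /eqP-> _|_ ci]; first exact: cm_refl cm _.
  by case: pickP => [//|/(_ i)]; rewrite ci.
have rho_out c : (forall i, ~~ r c (io i)) -> rho c = ord0.
  move=> no; rewrite /rho; case: pickP => [j /eqP e|_].
    by have := no j; rewrite e (cm_refl cm).
  by case: pickP => [j|//]; rewrite (negbTE (no j)).
have rho_r c c' : r c c' -> r (io (rho c)) (io (rho c')).
  move=> cc'; have [i ci|no] := pickP (fun i => r c (io i)).
    rewrite -(cm_ltrans cm (rho_in c i ci)) (cm_ltrans cm cc').
    by apply: (rho_in c' i); rewrite -(cm_ltrans cm cc').
  rewrite !rho_out ?(cm_refl cm) // => i; last by rewrite no.
  by rewrite -(cm_ltrans cm cc') no.
exists (rho \o f), (fun i j => r (io i) (io j)); split.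
- apply/equivalence_relP; split=> [i|i j ij k]; first exact: cm_refl cm _.
  by rewrite (cm_ltrans cm ij).
- by move=> bt c c'; apply: cm_total cm bt _ _.
- by move=> x y /(cm_adj cm)/rho_r.
- by move=> i; have [x ex] := cm_surj cm (io i); exists x; rewrite /= ex rhoK.
- move=> i j ij /(cm_edge cm)[|x [y [xy ex ey]]]; first by rewrite inj_eq.
  by exists x, y; rewrite /= ex ey !rhoK.
Qed.

Lemma identifiable_solvable b k (V : finType) (G : sgraph V) : k < #|V| ->
  identifiable (target b) k G <-> solvable_with b (#|V| - k) G.
Proof.
move=> kV; split=> [/identifiable_cluster_map[W [f [r [cm le]]]]|[f [r cm]]].
  by apply: cluster_map_shrink cm _; lia.
by apply: cluster_map_identifiable cm _; rewrite card_ord; lia.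
Qed.

(** Everything goes into one part; as parts are nonempty, a graph without vertices takes the
    identity map instead. *)
Lemma identifiable_large_budget b k (V : finType) (G : sgraph V) :
  #|V| <= k -> identifiable (target b) k G.
Proof.
move=> le; have [x _|V0] := pickP (@predT V); last first.
  apply: (@cluster_map_identifiable b k V V G id (fun _ _ => true)); last lia.
  by split=> // c; have := V0 c.
apply: (@cluster_map_identifiable b k V unit G (fun=> tt) (fun _ _ => true)).
  by split=> // -[]; exists x.
by rewrite card_unit; lia.
Qed.

(** * Sparse subgraphs carrying solutions *)

Section Degrees.

Variables (V : finType) (H : rel V).

Definition deg (u : V) : nat := \sum_v H u v.

Definition arcs : nat := \sum_u deg u.

Lemma deg_card u : deg u = #|[pred v | H u v]|.
Proof. by rewrite -sum1_card [RHS]big_mkcond; apply: eq_bigr => v _; rewrite inE; case: H. Qed.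

Lemma deg_gt0P u : reflect (exists v, H u v) (0 < deg u).
Proof.
rewrite deg_card; apply: (iffP card_gt0P) => -[v]; first by rewrite inE; exists v.
by move=> uv; exists v; rewrite inE.
Qed.

(** At most [#|U| * D] arcs start in [U], and by symmetry at most as many end there. *)
Lemma arc_avoiding (U : {set V}) D :
  symmetric H -> (forall u, deg u <= D) -> 2 * #|U| * D < arcs ->
  exists u v, [/\ H u v, u \notin U & v \notin U].
Proof.
move=> Hs degD.
have [[u v] /= /and3P[huv uU vU]|no] :=
    pickP (fun e : V * V => [&& H e.1 e.2, e.1 \notin U & e.2 \notin U]).
  by exists u, v.
suff le : arcs <= 2 * #|U| * D by lia.
have sumU : \sum_u (u \in U) * deg u <= #|U| * D.
  rewrite -sum_nat_const [leqRHS]big_mkcond; apply: leq_sum => u _.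
  by case: (u \in U); rewrite ?mul1n.
rewrite -mulnA mul2n -addnn; apply: leq_trans (leq_add sumU sumU).
have e2 : \sum_u (u \in U) * deg u = \sum_u \sum_v (v \in U) * H u v.
  rewrite [RHS]exchange_big; apply: eq_bigr => v _; rewrite big_distrr /=.
  by apply: eq_bigr => u _; rewrite Hs.
rewrite {2}e2 -big_split /=; apply: leq_sum => u _.
rewrite /deg big_distrr -big_split /=; apply: leq_sum => v _.
by have := no (u, v) => /=; case: (H u v) (u \in U) (v \in U) => [] [] [].
Qed.

End Degrees.

Section Recolouring.

Variables (V W : finType) (G : sgraph V) (H : rel V) (D : nat).
Hypotheses (Hsym : symmetric H) (HG : forall u v, H u v -> adj G u v).

(** [U] holds the vertices whose colour is frozen. Each edge of [s] freezes at most one more vertex,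
    so [#|U| + size s] stays at most [D] and a saturated vertex always has an [H]-neighbour outside
    [U]. By the last conclusion, new colours come from the same component. *)
Lemma reroute (s : seq (V * V)) (U : {set V}) (f : V -> W) :
  (forall u v, adj G u v -> [|| H u v, D <= deg H u | D <= deg H v]) ->
  (forall e, e \in s -> [/\ e.1 \in U, e.2 \in U & adj G e.1 e.2]) ->
  #|U| + size s <= D ->
  exists g : V -> W, [/\ {in U, g =1 f},
    forall e, e \in s -> exists u v, [/\ H u v, g u = f e.1 & g v = f e.2]
    & forall x, exists y, connect (adj G) x y /\ g x = f y].
Proof.
move=> sat; elim: s U f => [|[u v] s IH] U f sU le.
  by exists f; split=> // x; exists x; rewrite connect0.
have [/= uU vU uv] := sU _ (mem_head _ _).
have sU' e : e \in s -> [/\ e.1 \in U, e.2 \in U & adj G e.1 e.2].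
  by move=> es; apply: sU; rewrite inE es orbT.
have [huv|nuv] := boolP (H u v).
  have [|g [gU gs gc]] := IH U f sU'; first by rewrite /= in le; lia.
  exists g; split=> // e; rewrite inE => /orP[/eqP->|/gs //].
  by exists u, v; rewrite !gU.
(* The saturated endpoint [a] of the edge [ab] has a fresh neighbour, which takes
   over the colour of [b]. *)
have fresh a b : a \in U -> b \in U -> adj G a b -> D <= deg H a ->
    exists g : V -> W, [/\ {in U, g =1 f},
      forall e, e \in s -> exists u v, [/\ H u v, g u = f e.1 & g v = f e.2],
      forall x, exists y, connect (adj G) x y /\ g x = f y
      & exists2 w, H a w & g w = f b].
  move=> aU bU ab dega.
  have /subsetPn[w] : ~~ ([pred w | H a w] \subset U).
    by apply/negP => /subset_leq_card; rewrite -deg_card /= in le *; lia.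
  rewrite inE => haw wU.
  pose f' x := if x == w then f b else f x.
  have f'U x : x \in U -> f' x = f x.
    by rewrite /f'; case: eqP => // -> xU; rewrite xU in wU.
  have [||g [gU gs gc]] := IH (w |: U) f'.
  - by move=> e /sU'[e1 e2 e3]; rewrite !inE e1 e2 !orbT.
  - by rewrite cardsU1 wU /= in le *; lia.
  exists g; split.
  - by move=> x xU; rewrite gU ?f'U // inE xU orbT.
  - move=> e es; have [x [y [xy gx gy]]] := gs e es; have [e1 e2 _] := sU' e es.
    by exists x, y; rewrite gx gy !f'U.
  - move=> x; have [y [xy ->]] := gc x; rewrite /f'; case: eqP => [yw|_]; last by exists y.
    exists b; split=> //; apply: connect_trans xy _; rewrite yw.
    apply: (connect_trans (y := a)); apply: connect1 => //.
    by rewrite adj_sym; apply: HG.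
  - by exists w => //; rewrite gU ?inE ?eqxx // /f' eqxx.
have := sat u v uv; rewrite (negbTE nuv) /= => /orP[du|dv].
  have [g [gU gs gc [w uw gw]]] := fresh u v uU vU uv du.
  exists g; split=> // e; rewrite inE => /orP[/eqP->|/gs //].
  by exists u, w; rewrite gw gU.
rewrite adj_sym in uv.
have [g [gU gs gc [w vw gw]]] := fresh v u vU uU uv dv.
exists g; split=> // e; rewrite inE => /orP[/eqP->|/gs //].
by exists w, v; rewrite gw gU // Hsym.
Qed.

(** Each pair of colours is painted onto the ends of an [H]-edge avoiding [U], and both ends are
    then frozen; the bound on [arcs H] pays for two new vertices of [U] per pair. *)
Lemma realize_pairs (s : seq (W * W)) (U : {set V}) (f : V -> W) :
  (forall u, deg H u <= D) -> 0 < D -> 2 * (#|U| + 2 * size s) * D <= arcs H ->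
  exists g : V -> W, {in U, g =1 f} /\
    forall e, e \in s -> exists u v, [/\ H u v, g u = e.1 & g v = e.2].
Proof.
move=> degD D0; elim: s U f => [|[c c'] s IH] U f le; first by exists f.
have [|u [v [huv uU vU]]] := @arc_avoiding V H U D Hsym degD.
  by apply: leq_trans le => /=; nia.
have uv : u != v by apply/eqP => e; have := HG huv; rewrite e adj_irr.
pose f' x := if x == u then c else if x == v then c' else f x.
have [|g [gU gs]] := IH (u |: (v |: U)) f'.
  apply: leq_trans le; rewrite !cardsU1 !inE (negbTE uv) uU vU /=; nia.
exists g; split.
  move=> x xU; rewrite gU ?inE ?xU ?orbT // /f'.
  by case: eqP => [e|_]; [rewrite -e xU in uU|case: eqP => // e; rewrite -e xU in vU].
move=> e; rewrite inE => /orP[/eqP->|/gs //].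
exists u, v; split=> //; rewrite gU ?inE ?eqxx ?orbT // /f' ?eqxx //.
by rewrite eq_sym (negbTE uv).
Qed.

End Recolouring.

(** * Solutions of a graph and of its contraction *)

Section Contraction.

Variables (V V' : finType) (G : sgraph V) (G' : sgraph V').
Variables (emb : V' -> V) (phi : V -> V').
Hypothesis embK : cancel emb phi.
Hypothesis adj'P : forall a b, adj G' a b <->
  a != b /\ exists x y, [/\ adj G x y, phi x = a & phi y = b].

Lemma solvable_lift b p : solvable_with b p G' -> solvable_with b p G.
Proof.
move=> [f [r cm]]; exists (f \o phi), r; split.
- exact: cm_equiv cm.
- exact: cm_total cm.
- move=> x y xy /=; have [->|ne] := eqVneq (phi x) (phi y); first exact: cm_refl cm _.
  by apply: (cm_adj cm); apply/adj'P; split=> //; exists x, y.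
- by move=> c; have [a <-] := cm_surj cm c; exists (emb a); rewrite /= embK.
- move=> c c' cc' rcc'; have [a [a' [/adj'P[_ [x [y [xy <- <-]]]] <- <-]]] :=
    cm_edge cm cc' rcc'.
  by exists x, y.
Qed.

Variables (H : rel V) (D : nat).
Hypotheses (Hsym : symmetric H) (HG : forall u v, H u v -> adj G u v).
Hypothesis Hemb : forall u v, H u v -> emb (phi u) = u.

(** The ends of an [H]-edge are their own representatives, so [phi] keeps them apart. *)
Lemma H_adj' u v : H u v -> adj G' (phi u) (phi v).
Proof.
move=> uv; apply/adj'P; split; last by exists u, v; split=> //; apply: HG.
apply/eqP => /(congr1 emb); rewrite (Hemb uv) (Hemb (v := u)) 1?Hsym // => e.
by have := HG uv; rewrite e adj_irr.
Qed.

(** One witness edge per ordered pair of parts makes at most [p ^ 2] edges with [2 * p ^ 2] ends,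
    whence [3 * p ^ 2]. [reroute] moves them into [H], whose edges survive the contraction, and the
    new colouring is read off at the representatives. *)
Lemma solvable_push (b : bool) p :
  (forall u v, adj G u v -> [|| H u v, D <= deg H u | D <= deg H v]) ->
  3 * p ^ 2 <= D ->
  b \/ (forall x, connect (adj G) x (emb (phi x))) ->
  solvable_with b p G -> solvable_with b p G'.
Proof.
move=> sat pD conn [f [r cm]].
pose realizes (c : 'I_p * 'I_p) (e : V * V) :=
  [&& adj G e.1 e.2, f e.1 == c.1 & f e.2 == c.2].
pose s := pmap (fun c => [pick e | realizes c e]) (enum {: 'I_p * 'I_p}).
have szs : size s <= p ^ 2.
  by rewrite size_pmap (leq_trans (count_size _ _)) // -cardE card_prod card_ord -mulnn.
pose U := [set x in map fst s ++ map snd s].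
have cU : #|U| <= 2 * size s.
  by rewrite cardsE (leq_trans (card_size _)) // size_cat !size_map mul2n addnn.
have sP c c' : c != c' -> r c c' -> exists2 e, e \in s & f e.1 = c /\ f e.2 = c'.
  move=> cc' rcc'; have [x [y [xy fx fy]]] := cm_edge cm cc' rcc'.
  have : realizes (c, c') (x, y) by rewrite /realizes /= xy fx fy !eqxx.
  case E : [pick e | realizes (c, c') e] => [e|].
    move=> _; exists e; first by
      rewrite mem_pmap; apply/mapP; exists (c, c'); rewrite ?mem_enum.
    by move: E; case: pickP => // e' /and3P[_ /eqP h1 /eqP h2] [<-].
  by move: E; case: pickP => // no _; rewrite no.
have [e es||g [_ gs gc]] := reroute (s := s) (U := U) Hsym HG f sat.
- split; try by rewrite inE mem_cat map_f ?orbT.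
  move: es; rewrite mem_pmap => /mapP[c _].
  by case: pickP => // e' /and3P[h _ _] [->].
- apply: leq_trans (leq_trans (leq_add cU (leqnn _)) _) pD.
  by rewrite -mulSnr leq_mul2l.
have rg x : r (g (emb (phi x))) (f x).
  case: conn => [bt|conn]; first exact: cm_total cm bt _ _.
  have [y [xy ->]] := gc (emb (phi x)).
  rewrite (cm_sym cm); apply: (cm_connect cm).
  exact: connect_trans (conn x) xy.
have edge c c' : c != c' -> r c c' ->
    exists a a', [/\ adj G' a a', g (emb a) = c & g (emb a') = c'].
  move=> cc' rcc'; have [e es [<- <-]] := sP c c' cc' rcc'.
  have [u [v [uv gu gv]]] := gs e es.
  exists (phi u), (phi v); rewrite (Hemb uv) (Hemb (v := u)) 1?Hsym //.
  by split=> //; apply: H_adj'.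
exists (g \o emb), r; split=> //.
- exact: cm_equiv cm.
- exact: cm_total cm.
- move=> _ _ /adj'P[_ [x [y [xy <- <-]]]] /=.
  apply: (cm_trans cm) (rg x) _; apply: (cm_trans cm) (cm_adj cm xy) _.
  by rewrite (cm_sym cm).
(* If [c] is related to no other part, take a vertex [x] of [c]: the colour of its representative is
   related to [c] by [rg], hence equal to it. *)
- move=> c; have [c' /andP[cc' rcc']|no] := pickP (fun c' => (c != c') && r c c').
    by have [a [_ [_ <- _]]] := edge c c' cc' rcc'; exists a.
  have [x fx] := cm_surj cm c; exists (phi x) => /=; apply/esym/eqP.
  by have := no (g (emb (phi x))); rewrite -{2}fx (cm_sym cm) rg andbT; case: eqP.
Qed.

(** A constant colouring is overwritten until every ordered pair of the [p] colours, [(c, c)]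
    included, occurs on an [H]-edge. All parts may then be related, which serves both problems. *)
Lemma solvable_many_arcs b p :
  (forall u, deg H u <= D) -> 0 < D -> 4 * p ^ 2 * D <= arcs H -> 0 < p ->
  solvable_with b p G'.
Proof.
move=> degD D0 le p0.
have [|g [_ gs]] := @realize_pairs V 'I_p G H D Hsym HG
    (enum {: 'I_p * 'I_p}) set0 (fun=> Ordinal p0) degD D0.
  by rewrite cards0 add0n -cardE card_prod card_ord; apply: leq_trans le; lia.
have edge c c' : exists a a', [/\ adj G' a a', g (emb a) = c & g (emb a') = c'].
  have [|u [v [uv gu gv]]] := gs (c, c'); first by rewrite mem_enum.
  exists (phi u), (phi v); rewrite (Hemb uv) (Hemb (v := u)) 1?Hsym //.
  by split=> //; apply: H_adj'.
exists (g \o emb), (fun _ _ => true); split=> //.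
by move=> c; have [a [_ [_ <- _]]] := edge c c; exists a.
Qed.

End Contraction.

(** Each vertex [j i] gets its own part and all other vertices join part 0, which then contains
    every edge. With equality as the relation, no edge between parts is demanded. *)
Lemma solvable_isolated (V : finType) (G : sgraph V) p (j : 'I_p -> V) :
  0 < p -> injective j -> (forall i b, ~~ adj G (j i) b) -> solvable_with false p G.
Proof.
move=> p0 ji iso.
pose f a := odflt (Ordinal p0) [pick i | j i == a].
have fj i : f (j i) = i.
  by rewrite /f; case: pickP => [i' /eqP/ji //|/(_ i)]; rewrite eqxx.
have f0 a c : adj G a c -> f a = Ordinal p0.
  by move=> ac; rewrite /f; case: pickP => // i /eqP e; have := iso i c; rewrite e ac.
exists f, (fun i j => i == j); split=> //.
- by apply/equivalence_relP; split=> [i|i k /eqP -> //]; rewrite eqxx.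
- by move=> x y xy; rewrite (f0 _ _ xy) (f0 y x) // adj_sym.
- by move=> c; exists (j c).
- by move=> c c' /negbTE->.
Qed.

(** * Counting, ranks and invariants of folds *)

Lemma sum_pred (T : finType) (P : pred T) : \sum_x (P x : nat) = #|P|.
Proof.
by rewrite -sum1_card [RHS]big_mkcond; apply: eq_bigr => x _; rewrite unfold_in; case: (P x).
Qed.

Lemma card_le_codomain (T : finType) (P : pred T) (h : T -> nat) p :
  {in P &, injective h} -> (forall x, P x -> h x < p) -> #|P| <= p.
Proof.
case: p => [|p] hi hp.
  by rewrite leqn0; apply/pred0P => x; apply/negP => /hp.
rewrite -[p.+1]card_ord -(card_in_image (f := fun x => inord (h x) : 'I_p.+1)).
  exact: max_card.
by move=> x y xP yP /(congr1 val) /=; rewrite !inordK ?hp //; apply: hi.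
Qed.

Section Rank.

Variables (n : nat) (P : pred 'I_n).

Definition rank (x : 'I_n) : nat := \sum_(y < n) (P y && (y < x)).

Lemma rank_lt (x y : 'I_n) : P x -> x < y -> rank x < rank y.
Proof.
move=> Px xy; rewrite /rank (bigD1 x) //= [ltnRHS](bigD1 x) //= Px xy ltnn.
apply: leq_sum => z _; case: (P z) => //=.
by case: (ltnP z x) => // zx; rewrite (ltn_trans zx xy).
Qed.

Lemma rank_inj : {in P &, injective rank}.
Proof.
move=> x y Px Py e; apply: val_inj; case: (ltngtP x y) => // lt.
  by have := rank_lt Px lt; rewrite e ltnn.
by have := rank_lt Py lt; rewrite e ltnn.
Qed.

Lemma rank_lt_card (x : 'I_n) : P x -> rank x < #|P|.
Proof.
move=> Px; rewrite -sum_pred /rank (bigD1 x) //= [ltnRHS](bigD1 x) //= Px ltnn andbF.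
by apply: leq_sum => z _; case: (P z) => //=; case: (z < x).
Qed.

(** [rank] maps [P] injectively into the ordinals below [#|P|], so it is onto by cardinality. *)
Lemma rank_onto j : j < #|P| -> exists x, P x && (rank x == j).
Proof.
move=> jP.
pose h x := insubd (Ordinal jP) (rank x).
have hE x : P x -> val (h x) = rank x by move=> Px; rewrite insubdK ?unfold_in ?rank_lt_card.
have hi : {in P &, injective h}.
  by move=> x y Px Py /(congr1 val); rewrite !hE //; apply: rank_inj.
have : Ordinal jP \in image h P.
  have ch : #|image h P| = #|'I_#|P| | by rewrite card_in_image ?card_ord.
  by have /(subset_cardP ch)-> : image h P \subset 'I_#|P| by apply/subsetP.
by case/imageP => x Px /(congr1 val) /= e; exists x; apply/andP; split=> //;
  apply/eqP/esym/(etrans e)/hE.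
Qed.

End Rank.

Lemma foldl_inv (A B : Type) (F : A -> B -> A) (I : A -> Prop) (s : seq B) a :
  (forall a x, I a -> I (F a x)) -> I a -> I (foldl F a s).
Proof. by move=> h; elim: s a => //= x s IH a Ia; apply/IH/h. Qed.

Lemma foldl_done (A : Type) (B : eqType) (F : A -> B -> A) (I : A -> Prop)
    (done : B -> A -> Prop) (s : seq B) a x :
  (forall a x, I a -> I (F a x)) -> (forall a x, I a -> done x (F a x)) ->
  (forall a x y, I a -> done x a -> done x (F a y)) ->
  I a -> x \in s -> done x (foldl F a s).
Proof.
move=> hI hd hs; elim: s a => //= y s IH a Ia; rewrite inE => /orP[/eqP->|xs].
  suff [] : I (foldl F (F a y) s) /\ done y (foldl F (F a y) s) by [].
  apply: (foldl_inv (I := fun a => I a /\ done y a)) => [b z [Ib db]|].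
    by split; [apply: hI|apply: hs].
  by split; [apply: hI|apply: hd].
by apply: IH xs; apply: hI.
Qed.

(** * The kernel *)

Section Kernel.

Variables (n p : nat) (G : sgraph 'I_n).

(** The degree cap covers the [3 * p ^ 2] of [solvable_push], and the arc cap is the [4 * p ^ 2 * D]
    of [solvable_many_arcs]. The products are nested like the sums by which the program computes
    them. *)
Definition deg_cap : nat := 4 * (p * p).
Definition arc_cap : nat := 16 * (p * (p * (p * p))).

Definition greedy_step (u : 'I_n) (H : rel 'I_n) (v : 'I_n) : rel 'I_n :=
  fun i j => H i j ||
    [&& (i == u) && (j == v) || (i == v) && (j == u), adj G u v,
        deg H u < deg_cap, deg H v < deg_cap & arcs H < arc_cap].

Definition sparse : rel 'I_n :=
  foldl (fun H u => foldl (greedy_step u) H (enum 'I_n)) (fun _ _ => false)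
    (enum 'I_n).

Definition isolated (x : 'I_n) : bool := deg (adj G) x == 0.

(** The ends of sparse edges carry the solution. The first [p] vertices ensure that [p] of them
    remain when [p <= n], and that vertex 0, the last resort of [merged], is kept when [p > 0]. The
    first [p] isolated vertices preserve the easy cluster solution. *)
Definition kept (x : 'I_n) : bool :=
  [|| 0 < deg sparse x, x < p | isolated x && (rank isolated x < p)].

Definition has_kept_nbr (x : 'I_n) : bool := [exists z, kept z && adj G x z].

(* [x] is merged into [y]. The last case only concerns superfluous isolated
   vertices, and graphs in which [sparse] reached [arc_cap]. *)
Definition merged (x y : 'I_n) : bool :=
  if kept x then y == x else
  if has_kept_nbr x then
    [&& kept y, adj G x y & ~~ [exists z : 'I_n, [&& z < y, kept z & adj G x z]]]
  else y == 0 :> nat.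

Definition merged_adj (a b : 'I_n) : bool :=
  (a != b) && [exists x, exists y, [&& merged x a, merged y b & adj G x y]].

Definition kernel_emb (a : 'I_#|kept|) : 'I_n := xchoose (rank_onto (ltn_ord a)).

Definition kernel_rel : rel 'I_#|kept| :=
  fun a b => merged_adj (kernel_emb a) (kernel_emb b).

Lemma kernel_sym : symmetric kernel_rel.
Proof.
move=> a b; rewrite /kernel_rel /merged_adj eq_sym; congr (_ && _).
by apply/existsP/existsP => -[x /existsP[y /and3P[h1 h2 h3]]]; exists y;
  apply/existsP; exists x; rewrite h1 h2 adj_sym.
Qed.

Lemma kernel_irr : irreflexive kernel_rel.
Proof. by move=> a; rewrite /kernel_rel /merged_adj eqxx. Qed.

Definition kernel : sgraph 'I_#|kept| := SGraph kernel_sym kernel_irr.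

(** The successor allows for the last edge: it is added while [arcs H < arc_cap] and contributes two
    arcs. *)
Definition sparse_inv (H : rel 'I_n) : Prop :=
  [/\ symmetric H, forall u v, H u v -> adj G u v,
      forall u, deg H u <= deg_cap & arcs H <= arc_cap.+1].

Lemma greedy_step_le u H v i j :
  greedy_step u H v i j <= H i j + ((i == u) && (j == v)) + ((i == v) && (j == u)).
Proof.
by rewrite /greedy_step; case: (H i j) (i == u) (j == v) (i == v) (j == u) =>
  [] [] [] [] [] //=; case: (_ && _).
Qed.

Lemma deg_greedy_step u H v i :
  deg (greedy_step u H v) i <= deg H i + (i == u) + (i == v).
Proof.
apply: (@leq_trans
  (\sum_j (H i j + ((i == u) && (j == v)) + ((i == v) && (j == u))))).
  by apply: leq_sum => j _; apply: greedy_step_le.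
rewrite !big_split /= !leq_add //.
  by rewrite sum_pred; case: (i == u) => /=; rewrite ?card0 // (eq_card1 (x := v)).
by rewrite sum_pred; case: (i == v) => /=; rewrite ?card0 // (eq_card1 (x := u)).
Qed.

Lemma greedy_step_inv u H v : sparse_inv H -> sparse_inv (greedy_step u H v).
Proof.
move=> [Hs HG Hd Ha]; have [|ncond] := boolP [&& adj G u v,
    deg H u < deg_cap, deg H v < deg_cap & arcs H < arc_cap]; last first.
  have e i j : greedy_step u H v i j = H i j.
    by rewrite /greedy_step (negbTE ncond) andbF orbF.
  have ed i : deg (greedy_step u H v) i = deg H i by apply: eq_bigr => j _; rewrite e.
  split=> [i j|i j|i|]; rewrite ?e ?ed //; first exact: HG.
  by rewrite /arcs (eq_bigr _ (fun i _ => ed i)).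
move=> /and4P[uv du dv aM].
have nuv : u != v by apply/eqP => e; rewrite e adj_irr in uv.
split.
- move=> i j; rewrite /greedy_step Hs; congr (_ || (_ && _)).
  by case: (i == u) (j == v) (i == v) (j == u) => [] [] [] [].
- move=> i j /orP[/HG //|/andP[/orP[]/andP[/eqP-> /eqP->]]] //.
  by move=> _; rewrite (adj_sym G v).
- move=> i; apply: leq_trans (deg_greedy_step _ _ _ _) _.
  have [->|iu] := eqVneq i u; first by rewrite (negbTE nuv); lia.
  by have [->|iv] := eqVneq i v; [lia|rewrite !addn0].
- apply: (@leq_trans (\sum_i (deg H i + (i == u) + (i == v)))).
    by apply: leq_sum => i _; apply: deg_greedy_step.
  rewrite !big_split /= !sum_pred (eq_card1 (x := u)) // (eq_card1 (x := v)) //.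
  by rewrite -/(arcs H); lia.
Qed.

Lemma sparseP : sparse_inv sparse.
Proof.
apply: foldl_inv => [H u IH|].
  by apply: foldl_inv IH => {}H v IH; apply: greedy_step_inv.
have d0 : forall u, deg (fun _ _ : 'I_n => false) u = 0 by move=> u; apply: big1.
by split=> // [u|]; rewrite ?d0 // /arcs (eq_bigr _ (fun u _ => d0 u)) big1_eq.
Qed.

(** At its turn the edge is taken unless a cap blocks it; the relation only grows, so either outcome
    persists. *)
Lemma sparse_saturated u v : adj G u v ->
  [|| sparse u v, deg_cap <= deg sparse u, deg_cap <= deg sparse v
    | arc_cap <= arcs sparse].
Proof.
move=> uv.
pose done (e : 'I_n * 'I_n) (H : rel 'I_n) : Prop := adj G e.1 e.2 ->
  [|| H e.1 e.2, deg_cap <= deg H e.1, deg_cap <= deg H e.2 | arc_cap <= arcs H].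
have mono (H H' : rel 'I_n) e : (forall i j, H i j -> H' i j) -> done e H -> done e H'.
  move=> le dH /dH.
  have led i : deg H i <= deg H' i.
    by apply: leq_sum => j _; have := le i j; case: (H i j) => // ->.
  have lea : arcs H <= arcs H' by apply: leq_sum.
  case/or4P => h; apply/or4P;
    [apply: Or41; apply: le | apply: Or42 | apply: Or43 | apply: Or44] => //;
    exact: leq_trans h _.
have step_le w (H : rel 'I_n) z i j : H i j -> greedy_step w H z i j.
  by rewrite /greedy_step => ->.
have fold_le w (H : rel 'I_n) s i j : H i j -> foldl (greedy_step w) H s i j.
  by elim: s H => //= z s IH H h; apply/IH/step_le.
suff h : forall v, done (u, v) sparse by apply: (h v uv).
apply: (foldl_done (I := fun=> True) (done := fun u H => forall v, done (u, v) H)) => //.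
- move=> H w _ z.
  apply: (foldl_done (I := fun=> True) (done := fun z H => done (w, z) H)) => //.
  + move=> {}H y _.
    have [/and3P[d1 d2 d3]|nd] :=
        boolP [&& deg H w < deg_cap, deg H y < deg_cap & arcs H < arc_cap].
      by move=> /= wy; rewrite {1}/greedy_step wy !eqxx d1 d2 d3 orbT.
    apply: (mono H) => //; first by move=> i j; apply: step_le.
    by move=> _; move: nd; rewrite !negb_and -!leqNgt /= => ->; rewrite orbT.
  + by move=> {}H y y' _; apply: mono => i j; apply: step_le.
  + by rewrite mem_enum.
- by move=> H w y _ h z; apply: mono (h z) => i j; apply: fold_le.
- by rewrite mem_enum.
Qed.

(** There are no more vertices of positive sparse degree than sparse arcs, and the other two
    conditions add at most [p] vertices each. *)
Lemma kept_card_le : #|kept| <= arc_cap.+1 + (p + p).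
Proof.
have [_ _ _ Ha] := sparseP.
rewrite -sum_pred; apply: (@leq_trans (\sum_(x < n)
    (deg sparse x + ((x < p) + (isolated x && (rank isolated x < p)))))).
  apply: leq_sum => x _; rewrite /kept; case: (deg sparse x) => //=.
  by case: (x < p) => //=; rewrite add0n.
rewrite big_split leq_add //= big_split leq_add //= sum_pred.
  by apply: (card_le_codomain (h := @nat_of_ord n)) => // x y _ _ /val_inj.
apply: (card_le_codomain (h := rank isolated)) => [x y|x /andP[]] //.
by move=> /andP[ix _] /andP[iy _]; apply: rank_inj.
Qed.

Lemma kept_card_ge : p <= n -> p <= #|kept|.
Proof.
move=> pn; rewrite -{1}[p]card_ord.
rewrite -(card_image (f := widen_ord pn)); last by move=> i j [] /val_inj.
apply: subset_leq_card; apply/subsetP => x /imageP[i _ ->].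
by rewrite unfold_in /kept /= ltn_ord orbT.
Qed.

Lemma kernel_emb_kept a : kept (kernel_emb a).
Proof. by have /andP[] := xchooseP (rank_onto (ltn_ord a)). Qed.

Lemma kernel_emb_rank a : rank kept (kernel_emb a) = a.
Proof. by have /andP[_ /eqP] := xchooseP (rank_onto (ltn_ord a)). Qed.

Lemma kernel_emb_inj : injective kernel_emb.
Proof. by move=> a b e; apply: val_inj; rewrite /= -!kernel_emb_rank e. Qed.

Lemma kernel_emb_onto x : kept x -> exists a, kernel_emb a = x.
Proof.
move=> kx; exists (Ordinal (rank_lt_card kx)).
by apply: (@rank_inj n kept) => //; [apply: kernel_emb_kept | rewrite kernel_emb_rank].
Qed.

Lemma merged_unique x y z : merged x y -> merged x z -> y = z.
Proof.
rewrite /merged; case: ifP => _; first by move=> /eqP-> /eqP->.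
case: ifP => _; last by move=> /eqP y0 /eqP z0; apply: val_inj; rewrite /= y0 z0.
move=> /and3P[ky xy ny] /and3P[kz xz nz]; apply: val_inj.
case: (ltngtP y z) => // lt.
  by case/negP: nz; apply/existsP; exists y; rewrite lt ky.
by case/negP: ny; apply/existsP; exists z; rewrite lt kz.
Qed.

Lemma merged_kept x y : 0 < p -> merged x y -> kept y.
Proof.
move=> p0; rewrite /merged; case: ifP => [kx /eqP-> //|_]; case: ifP => [_ /and3P[]|_] //.
by move=> /eqP y0; rewrite /kept y0 p0 orbT.
Qed.

Lemma merged_total x : exists y, merged x y.
Proof.
have [kx|/negbTE kx] := boolP (kept x); first by exists x; rewrite /merged kx.
have [hx|/negbTE hx] := boolP (has_kept_nbr x); last first.
  by exists (Ordinal (leq_ltn_trans (leq0n _) (ltn_ord x))); rewrite /merged kx hx.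
have /existsP[z0 z0P] := hx.
have [z /andP[kz xz] zmin] := @arg_minnP _ z0
  (fun z => kept z && adj G x z) (fun z : 'I_n => z : nat) z0P.
exists z; rewrite /merged kx hx kz xz; apply/negP => /existsP[y /and3P[yz ky xy]].
by have := zmin y; rewrite ky xy leqNgt yz => /(_ isT).
Qed.

(** Solutions of the kernel always lift. Conversely, if [sparse] reached [arc_cap], the kernel is
    solvable outright; otherwise [solvable_push] applies, unless cluster graphs are sought and an
    isolated vertex was dropped, in which case [p] isolated vertices of the kernel give a
    solution. *)
Lemma kernel_solvable b : 0 < p <= n ->
  solvable_with b p G <-> solvable_with b p kernel.
Proof.
move=> /andP[p0 pn].
have /fin_all_exists[phi phiP] x : exists a, merged x (kernel_emb a).
  have [y xy] := merged_total x.
  by have [a ea] := kernel_emb_onto (merged_kept p0 xy); exists a; rewrite ea.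
have mergedE x a : merged x (kernel_emb a) = (phi x == a).
  apply/idP/eqP => [h|<-]; last exact: phiP.
  by apply: kernel_emb_inj; apply: merged_unique (phiP x) h.
have kept_phi x : kept x -> kernel_emb (phi x) = x.
  by move=> kx; have := phiP x; rewrite /merged kx => /eqP.
have embK : cancel kernel_emb phi.
  by move=> a; apply/kernel_emb_inj/kept_phi/kernel_emb_kept.
have adjP a c : adj kernel a c <->
    a != c /\ exists x y, [/\ adj G x y, phi x = a & phi y = c].
  rewrite /= /kernel_rel /merged_adj inj_eq; last exact: kernel_emb_inj.
  split=> [/andP[ac /existsP[x /existsP[y]]]|[-> [x [y [xy ex ey]]]]].
    by rewrite !mergedE => /and3P[/eqP ex /eqP ey xy]; split=> //; exists x, y.
  by apply/existsP; exists x; apply/existsP; exists y; rewrite !mergedE ex ey !eqxx.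
split=> [sG|]; last exact: solvable_lift embK adjP _ _.
have [Hs HG Hd _] := sparseP.
have Hemb u v : sparse u v -> kernel_emb (phi u) = u.
  move=> uv; apply: kept_phi; rewrite /kept.
  by apply/orP; left; apply/deg_gt0P; exists v.
have [big|small] := leqP arc_cap (arcs sparse).
  apply: (solvable_many_arcs adjP Hs HG Hemb b Hd) => //.
    by rewrite /deg_cap !muln_gt0 p0.
  by apply: leq_trans big; rewrite /deg_cap /arc_cap -mulnn; nia.
have sat u v : adj G u v ->
    [|| sparse u v, deg_cap <= deg sparse u | deg_cap <= deg sparse v].
  by move=> /sparse_saturated; rewrite [arc_cap <= _]leqNgt small orbF.
(* If [x] is not kept, it has sparse degree 0, so saturation of the edge [xy] must come from [y].
   Then [y] is kept, and [x] is merged into a kept neighbour. *)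
have near x y z : adj G x y -> merged x z -> x = z \/ adj G x z.
  rewrite /merged => xy; case: ifP => [kx /eqP|kx]; first by left.
  case: ifP => [_ /and3P[]|/existsP[]]; first by right.
  exists y; rewrite xy andbT /kept; move: kx; rewrite /kept.
  case: (posnP (deg sparse x)) => // dx _.
  have := sat x y xy; rewrite dx leqn0 /deg_cap !muln_eq0 /= orbb.
  have [/eqP p00|_ /=] := boolP (p == 0); first by rewrite p00 in p0.
  case/orP => [sxy|dy]; first by move/eqP: dx; rewrite eqn0Ngt; case/deg_gt0P; exists y.
  by rewrite (leq_trans _ dy) // !muln_gt0 p0.
have nonisolated x y : adj G x y -> ~~ isolated x.
  by move=> xy; rewrite /isolated -lt0n; apply/deg_gt0P; exists y.
have [/orP bx|] := boolP (b || [forall x, isolated x ==> kept x]).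
  apply: (solvable_push adjP Hs HG Hemb sat _ _ sG); first by rewrite /deg_cap -mulnn; lia.
  case: bx => [bt|/forallP allk]; [by left|right] => x.
  have [kx|nkx] := boolP (kept x); first by rewrite kept_phi.
  have : ~~ isolated x by apply: contra nkx; apply/implyP.
  rewrite /isolated -lt0n => /deg_gt0P[y xy].
  by have [<-|xz] := near x y _ xy (phiP x); [exact: connect0|exact: connect1].
rewrite negb_or => /andP[/negbTE-> /forallPn[x]]; rewrite negb_imply => /andP[ix nkx].
have rx : p <= rank isolated x.
  by rewrite leqNgt; apply: contra nkx => h; rewrite /kept ix h !orbT.
have /fin_all_exists[j jP] (i : 'I_p) : exists a,
    isolated (kernel_emb a) /\ rank isolated (kernel_emb a) = i.
  have [|y /andP[iy /eqP ry]] := @rank_onto n isolated i.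
    by apply: leq_ltn_trans (rank_lt_card ix); apply: leq_trans (ltnW (ltn_ord i)) rx.
  have ky : kept y by rewrite /kept iy ry ltn_ord !orbT.
  by have [a ea] := kernel_emb_onto ky; exists a; rewrite ea.
apply: (@solvable_isolated _ _ _ j) => //.
  by move=> i i' e; apply: val_inj; have [_ /= <-] := jP i; have [_ /= <-] := jP i'; rewrite e.
(* An edge at [j i] would stem from an edge [yz] of [G] with [y] merged into the vertex behind
   [j i]. By [near], [y] is that vertex or adjacent to it, but the vertex is isolated. *)
move=> i c; apply/negP => /adjP[_ [y [z [yz ey _]]]].
have [iso _] := jP i; rewrite -ey in iso.
have [e|ye] := near y z _ yz (phiP y).
  by case/negP: (nonisolated y z yz); rewrite e.
by rewrite adj_sym in ye; case/negP: (nonisolated _ _ ye).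
Qed.

End Kernel.

(** * Total correctness of machine programs with a bound on the number of steps *)

Definition runs (c : ram) (s : ram_state) (B : nat) (Q : ram_state -> Prop) :=
  exists t s', [/\ ram_exec c s t s', t <= B & Q s'].

Lemma runs_weaken c s B B' (Q Q' : ram_state -> Prop) :
  runs c s B Q -> B <= B' -> (forall s', Q s' -> Q' s') -> runs c s B' Q'.
Proof.
move=> [t [s' [e le q]]] leB QQ'; exists t, s'; split=> //; last exact: QQ'.
exact: leq_trans leB.
Qed.

Lemma runs_const i a s (Q : ram_state -> Prop) :
  Q (set_reg s i a) -> runs (Const i a) s 1 Q.
Proof. by move=> q; exists 1, (set_reg s i a); split=> //; constructor. Qed.

Lemma runs_add i j k s (Q : ram_state -> Prop) :
  Q (set_reg s i (reg s j + reg s k)) -> runs (Add i j k) s 1 Q.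
Proof. by move=> q; eexists 1, _; split; [constructor| |]. Qed.

Lemma runs_sub i j k s (Q : ram_state -> Prop) :
  Q (set_reg s i (reg s j - reg s k)) -> runs (Sub i j k) s 1 Q.
Proof. by move=> q; eexists 1, _; split; [constructor| |]. Qed.

Lemma runs_read i j s (Q : ram_state -> Prop) :
  Q (set_reg s i (mem s (reg s j))) -> runs (Read i j) s 1 Q.
Proof. by move=> q; eexists 1, _; split; [constructor| |]. Qed.

Lemma runs_write i j s (Q : ram_state -> Prop) :
  Q (set_mem s (reg s i) (reg s j)) -> runs (Write i j) s 1 Q.
Proof. by move=> q; eexists 1, _; split; [constructor| |]. Qed.

Lemma runs_skip s (Q : ram_state -> Prop) : Q s -> runs Skip s 1 Q.
Proof. by move=> q; exists 1, s; split=> //; constructor. Qed.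

Lemma runs_seq c1 c2 s B1 B2 (Q : ram_state -> Prop) :
  runs c1 s B1 (fun s' => runs c2 s' B2 Q) -> runs (Seq c1 c2) s (B1 + B2) Q.
Proof.
move=> [t1 [s1 [e1 le1 [t2 [s2 [e2 le2 q]]]]]].
by exists (t1 + t2), s2; split=> //; [apply: ExecSeq e1 e2 | apply: leq_add].
Qed.

Lemma runs_if i c1 c2 s B1 B2 (Q : ram_state -> Prop) :
  (reg s i != 0 -> runs c1 s B1 Q) -> (reg s i = 0 -> runs c2 s B2 Q) ->
  runs (If i c1 c2) s (B1 + B2).+1 Q.
Proof.
move=> h1 h2; have [ri|ri] := eqVneq (reg s i) 0.
  have [t [s' [e le q]]] := h2 ri; exists t.+1, s'; split=> //; last lia.
  exact: ExecIfFalse.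
have [t [s' [e le q]]] := h1 ri; exists t.+1, s'; split=> //; last lia.
exact: ExecIfTrue.
Qed.

(** The invariant is indexed by the number of rounds left, which is the value of the tested
    register. Each round pays one step for its test, and leaving the loop costs one more. *)
Lemma runs_while i c B (I : nat -> ram_state -> Prop) m s :
  (forall a s, I a s -> reg s i = a) ->
  (forall a s, I a.+1 s -> runs c s B (I a)) ->
  I m s -> runs (While i c) s (m * B.+1).+1 (I 0).
Proof.
move=> Ireg step; elim: m s => [|m IH] s Is.
  exists 1, s; split=> //; constructor; exact: Ireg Is.
have [t1 [s1 [e1 le1 I1]]] := step _ _ Is.
have [t2 [s2 [e2 le2 I2]]] := IH _ I1.
exists (t1 + t2).+1, s2; split=> //; last by lia.
by apply: ExecWhileStep e1 e2; rewrite (Ireg _ _ Is).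
Qed.

(** * A language of table programs *)

(* Variables are de Bruijn levels: the outermost binder binds variable 0. All
   variables range over the vertices [0, ..., n - 1]. *)
Inductive exp :=
  | Num of nat
  | Bound
  | Budget
  | Var of nat
  | Plus of exp & exp
  | Minus of exp & exp
  | Get of nat & nat & nat     (* table, row variable, column variable *)
  | Cond of exp & exp & exp
  | Sum of exp.

Inductive cmd :=
  | SetT of nat & exp          (* the two new variables are row and column *)
  | Then of cmd & cmd
  | For of cmd.

Definition tables := nat -> nat -> nat -> nat.

Section Semantics.

Variables (n K : nat).

Fixpoint eval (d : nat) (T : tables) (env : nat -> nat) (e : exp) : nat :=
  match e with
  | Num a => a
  | Bound => n
  | Budget => K
  | Var x => env x
  | Plus a b => eval d T env a + eval d T env b
  | Minus a b => eval d T env a - eval d T env b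
  | Get k x y => T k (env x) (env y)
  | Cond a b c =>
      if eval d T env a != 0 then eval d T env b else eval d T env c
  | Sum a => \sum_(i < n) eval d.+1 T (upd env d i) a
  end.

Fixpoint exec (d : nat) (env : nat -> nat) (c : cmd) (T : tables) : tables :=
  match c with
  | SetT k e => fun k' i j =>
      if k' == k then eval d.+2 T (upd (upd env d i) d.+1 j) e else T k' i j
  | Then c1 c2 => exec d env c2 (exec d env c1 T)
  | For c => iteri n (fun i => exec d.+1 (upd env d i) c) T
  end.

End Semantics.

Fixpoint wf_exp (d : nat) (e : exp) : bool :=
  match e with
  | Num _ | Bound | Budget => true
  | Var x => x < d
  | Plus a b | Minus a b => wf_exp d a && wf_exp d b
  | Get _ x y => (x < d) && (y < d)
  | Cond a b c => [&& wf_exp d a, wf_exp d b & wf_exp d c]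
  | Sum a => wf_exp d.+1 a
  end.

Fixpoint reads (k : nat) (e : exp) : bool :=
  match e with
  | Num _ | Bound | Budget | Var _ => false
  | Plus a b | Minus a b => reads k a || reads k b
  | Get k' _ _ => k' == k
  | Cond a b c => [|| reads k a, reads k b | reads k c]
  | Sum a => reads k a
  end.

(** An assigned table is not read by its own expression: the compiled code overwrites it cell by
    cell, whereas [exec] assigns all cells at once. *)
Fixpoint wf_cmd (d : nat) (c : cmd) : bool :=
  match c with
  | SetT k e => wf_exp d.+2 e && ~~ reads k e
  | Then c1 c2 => wf_cmd d c1 && wf_cmd d c2
  | For c => wf_cmd d.+1 c
  end.

(* Registers 2, 4 and 6 hold [n], [n ^ 2] and the budget. Variable [x] occupies
   register [4 * x + 1], and register [4 * x + 3] holds [n] times its value. The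
   even registers [2 * r] with [r >= 4] are a stack of temporaries. *)
Definition move (i j : nat) : ram := Seq (Const i 0) (Add i i j).

(** Register [2 * r + 2] counts down from [n]. The multiple of the variable by [n] is stepped along,
    as the machine cannot multiply. Register [2 * r + 4] is set to 1 only after the body, which may
    use it as a temporary; register [2 * r] is left to the body as an accumulator. *)
Definition loop (d r : nat) (body : ram) : ram :=
  Seq (move (2 * r + 2) 2)
  (Seq (Const (4 * d + 1) 0)
  (Seq (Const (4 * d + 3) 0)
  (While (2 * r + 2)
    (Seq body
    (Seq (Const (2 * r + 4) 1)
    (Seq (Add (4 * d + 1) (4 * d + 1) (2 * r + 4))
    (Seq (Add (4 * d + 3) (4 * d + 3) 2)
         (Sub (2 * r + 2) (2 * r + 2) (2 * r + 4))))))))).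

Fixpoint add_times (k i j : nat) : ram :=
  if k is k'.+1 then Seq (Add i i j) (add_times k' i j) else Skip.

Definition get_addr (r k x y : nat) : ram :=
  Seq (Const (2 * r) 2)
  (Seq (add_times k (2 * r) 4)
  (Seq (Add (2 * r) (2 * r) (4 * x + 3)) (Add (2 * r) (2 * r) (4 * y + 1)))).

Fixpoint comp_exp (d r : nat) (e : exp) : ram :=
  match e with
  | Num a => Const (2 * r) a
  | Bound => move (2 * r) 2
  | Budget => move (2 * r) 6
  | Var x => move (2 * r) (4 * x + 1)
  | Plus a b => Seq (comp_exp d r a)
      (Seq (comp_exp d r.+1 b) (Add (2 * r) (2 * r) (2 * r.+1)))
  | Minus a b => Seq (comp_exp d r a)
      (Seq (comp_exp d r.+1 b) (Sub (2 * r) (2 * r) (2 * r.+1)))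
  | Get k x y => Seq (get_addr r k x y) (Read (2 * r) (2 * r))
  | Cond a b c => Seq (comp_exp d r a)
      (If (2 * r) (comp_exp d r b) (comp_exp d r c))
  | Sum a => Seq (Const (2 * r) 0)
      (loop d r (Seq (comp_exp d.+1 r.+2 a) (Add (2 * r) (2 * r) (2 * r.+2))))
  end.

Fixpoint comp_cmd (d r : nat) (c : cmd) : ram :=
  match c with
  | SetT k e =>
      loop d r (loop d.+1 r.+2
        (Seq (comp_exp d.+2 (r + 4) e)
        (Seq (get_addr (r + 5) k d d.+1) (Write (2 * (r + 5)) (2 * (r + 4))))))
  | Then c1 c2 => Seq (comp_cmd d r c1) (comp_cmd d r c2)
  | For c => loop d r (comp_cmd d.+1 r.+2 c)
  end.

(** The bound depends on [n] alone because every loop makes [n] rounds; a conditional is charged for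
    both branches. *)
Fixpoint exp_cost (n : nat) (e : exp) : nat :=
  match e with
  | Num _ => 1
  | Bound | Budget | Var _ => 2
  | Plus a b | Minus a b => exp_cost n a + (exp_cost n b + 1)
  | Get k _ _ => k + 5
  | Cond a b c => exp_cost n a + (exp_cost n b + exp_cost n c).+1
  | Sum a => n * (exp_cost n a + 6) + 6
  end.

Fixpoint cmd_cost (n : nat) (c : cmd) : nat :=
  match c with
  | SetT k e => n * (n * (exp_cost n e + (k + 10)) + 10) + 5
  | Then c1 c2 => cmd_cost n c1 + cmd_cost n c2
  | For c => n * (cmd_cost n c + 5) + 5
  end.

(** * Correctness of the compiler *)

Section Correctness.

Variables (n K : nat).

(** The frame condition of code compiled at depth [d] and stack height [r]. *)
Definition keep (d r : nat) (s s' : ram_state) : Prop :=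
  (forall x, x < d -> reg s' (4 * x + 1) = reg s (4 * x + 1) /\
                      reg s' (4 * x + 3) = reg s (4 * x + 3)) /\
  (forall q, q < r -> reg s' (2 * q) = reg s (2 * q)).

Lemma keep_trans d r s2 s1 s3 : keep d r s1 s2 -> keep d r s2 s3 -> keep d r s1 s3.
Proof.
move=> [a b] [a' b']; split=> [x xd|q qr].
  by have [-> ->] := a' x xd; apply: a.
by rewrite b' // b.
Qed.

Lemma keep_le d r d' r' s s' :
  keep d' r' s s' -> d <= d' -> r <= r' -> keep d r s s'.
Proof. by move=> [a b] ld lr; split=> [x xd|q qr]; [apply: a|apply: b]; lia. Qed.

Lemma upd_same f i a : upd f i a i = a.
Proof. by rewrite /upd eqxx. Qed.

Lemma upd_other f i a j : j <> i -> upd f i a j = f j.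
Proof. by rewrite /upd => /eqP/negbTE->. Qed.

Lemma keep_tmp d r s q a : r <= q -> keep d r s (set_reg s (2 * q) a).
Proof. by move=> rq; split=> [x xd|z zr] /=; rewrite ?upd_other //; lia. Qed.

Lemma runs_move i j s (Q : ram_state -> Prop) :
  i <> j ->
  Q (set_reg (set_reg s i 0) i (reg s j)) -> runs (move i j) s 2 Q.
Proof.
move=> ij q; apply: (@runs_seq _ _ _ 1 1); apply/runs_const/runs_add => /=.
by rewrite upd_same upd_other // => /esym.
Qed.

Ltac updr := rewrite /=;
  repeat first [rewrite upd_same | rewrite upd_other; last by lia].

(** [I] is indexed by the rounds done and sees the memory and the accumulator. The final value of
    register [4 * d + 3] is how the machine obtains [n ^ 2]. *)
Lemma runs_loop d r body B (I : nat -> (nat -> nat) -> nat -> Prop) s0 :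
  reg s0 2 = n -> 2 <= r ->
  I 0 (mem s0) (reg s0 (2 * r)) ->
  (forall i s, i < n -> keep d r s0 s -> I i (mem s) (reg s (2 * r)) ->
     reg s (4 * d + 1) = i -> reg s (4 * d + 3) = i * n ->
     runs body s B (fun s' => [/\ keep d.+1 r s s',
       reg s' (2 * r + 2) = reg s (2 * r + 2)
       & I i.+1 (mem s') (reg s' (2 * r))])) ->
  runs (loop d r body) s0 (n * (B + 5) + 5) (fun s' =>
    [/\ keep d r s0 s', I n (mem s') (reg s' (2 * r))
      & reg s' (4 * d + 3) = n * n]).
Proof.
move=> s0n r2 I0 step.
pose J a s := [/\ reg s (2 * r + 2) = a, a <= n, keep d r s0 s,
  I (n - a) (mem s) (reg s (2 * r)) & reg s (4 * d + 1) = n - a /\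
  reg s (4 * d + 3) = (n - a) * n].
have -> : n * (B + 5) + 5 = 2 + (1 + (1 + (n * (B + 4).+1).+1)) by lia.
apply: runs_seq; apply: runs_move; first lia.
apply/runs_seq/runs_const/runs_seq/runs_const.
apply: (@runs_weaken _ _ _ _ (J 0)); last 2 first.
- exact: leqnn.
- by move=> s [_ _ k i [_ e]]; rewrite subn0 in i e.
apply: (runs_while (I := J)).
- by move=> a s [].
- move=> a s [sr an ks Is [sv sw]].
  have -> : B + 4 = B + (1 + (1 + (1 + 1))) by lia.
  apply: runs_seq.
  have := step (n - a.+1) s; case/(_ _ ks Is sv sw); first lia.
  move=> t [s1 [e1 le1 [k1 r1 I1]]]; exists t, s1; split=> //.
  do 3! [apply: runs_seq; (apply: runs_const || apply: runs_add)].
  apply: runs_sub.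
  have s1n : reg s1 2 = n.
    by rewrite (k1.2 1) // (ks.2 1).
  have [v1 v3] := k1.1 d (ltnSn d).
  split.
  + by updr; rewrite r1 sr; lia.
  + lia.
  + apply: (keep_trans ks); apply: (keep_trans (keep_le k1 (leqnSn _) (leqnn _))).
    by split=> [x xd|q qr]; updr.
  + by updr; rewrite (_ : n - a = (n - a.+1).+1) //; lia.
  + have -> : n - a = (n - a.+1).+1 by lia.
    by split; updr; rewrite ?v1 ?sv ?v3 ?sw ?s1n; [rewrite addn1|rewrite mulSn addnC].
- split.
  + by updr.
  + exact: leqnn.
  + by split=> [x xd|q qr]; updr.
  + by updr; rewrite subnn.
  + by split; updr; rewrite subnn.
Qed.


(** Starting at cell 2 makes table 0 coincide with the adjacency matrix of the input. *)
Definition addr (k i j : nat) : nat := 2 + k * (n * n) + i * n + j.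

Definition agrees (m : nat -> nat) (T : tables) : Prop :=
  forall k i j, i < n -> j < n -> m (addr k i j) = T k i j.

Lemma addr_inj k i j k' i' j' : i < n -> j < n -> i' < n -> j' < n ->
  addr k i j = addr k' i' j' -> [/\ k = k', i = i' & j = j'].
Proof.
move=> li lj li' lj'; rewrite /addr -!addnA => /addnI e.
have e1 : (k * n + i) * n + j = (k' * n + i') * n + j' by nia.
have e2 : k * n + i = k' * n + i'.
  by have /(congr1 (divn^~ n)) := e1; rewrite !divnMDl ?divn_small ?addn0 //; lia.
have e3 : k = k'.
  by have /(congr1 (divn^~ n)) := e2; rewrite !divnMDl ?divn_small ?addn0 //; lia.
by rewrite e3 in e2 *; split=> //; lia.
Qed.

Record good (d : nat) (env : nat -> nat) (s : ram_state) : Prop := Good {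
  good_n : reg s 2 = n;
  good_nn : reg s 4 = n * n;
  good_K : reg s 6 = K;
  good_var : forall x, x < d -> [/\ env x < n, reg s (4 * x + 1) = env x
                                 & reg s (4 * x + 3) = env x * n]
}.

Lemma good_keep d r env s s' :
  4 <= r -> keep d r s s' -> good d env s -> good d env s'.
Proof.
move=> r4 [kv kt] [sn snn sK sv]; split.
- by rewrite (kt 1) //; lia.
- by rewrite (kt 2) //; lia.
- by rewrite (kt 3) //; lia.
by move=> x xd; have [-> ->] := kv x xd; apply: sv.
Qed.

Lemma good_bind d env s i :
  good d env s -> i < n -> reg s (4 * d + 1) = i -> reg s (4 * d + 3) = i * n ->
  good d.+1 (upd env d i) s.
Proof.
move=> [sn snn sK sv] li s1 s3; split=> // x xd.
have [->|xd'] := eqVneq x d; first by rewrite upd_same.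
by rewrite upd_other; [apply: sv; lia | apply/eqP].
Qed.

Lemma runs_add_times k i j s :
  i <> j -> runs (add_times k i j) s k.+1 (fun s' =>
    [/\ reg s' i = reg s i + k * reg s j, mem s' = mem s
      & forall q, q <> i -> reg s' q = reg s q]).
Proof.
move=> ij; elim: k s => [|k IH] s /=; first by apply: runs_skip; rewrite addn0.
have -> : k.+2 = 1 + k.+1 by [].
apply/runs_seq/runs_add; apply: runs_weaken (IH _) (leqnn _) _ => s' /=.
rewrite upd_same upd_other => [|/esym //].
move=> [-> -> h]; split=> //; first lia.
by move=> q qi; rewrite h // upd_other.
Qed.

Lemma runs_get_addr d env r k x y s :
  4 <= r -> x < d -> y < d -> good d env s ->
  runs (get_addr r k x y) s (k + 4) (fun s' =>
    [/\ keep d r s s', mem s' = mem s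
      & reg s' (2 * r) = addr k (env x) (env y)]).
Proof.
move=> r4 xd yd [sn snn sK sv].
have -> : k + 4 = 1 + (k.+1 + (1 + 1)) by lia.
apply/runs_seq/runs_const/runs_seq.
apply: runs_weaken (runs_add_times _ _ _) (leqnn _) _; first lia.
move=> s1 /=; rewrite upd_same upd_other; last lia.
move=> [e1 m1 q1].
apply/runs_seq/runs_add/runs_add.
have [_ x1 x3] := sv x xd; have [_ y1 y3] := sv y yd.
split=> //.
- by split=> [z zd|q qr]; rewrite /= !upd_other ?q1 ?upd_other //; lia.
- updr; rewrite e1 !q1; try lia.
  by updr; rewrite snn x3 y1.
Qed.


Lemma comp_exp_correct e d r env T s :
  4 <= r -> wf_exp d e -> good d env s -> agrees (mem s) T ->
  runs (comp_exp d r e) s (exp_cost n e) (fun s' =>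
    [/\ keep d r s s', mem s' = mem s
      & reg s' (2 * r) = eval n K d T env e]).
Proof.
elim: e d r env s =>
    [a|||x|a IHa b IHb|a IHa b IHb|k x y|a IHa b IHb c IHc|a IHa]
    d r env s r4 /=.
- move=> _ gs ag; apply: runs_const; split=> //; first exact: keep_tmp.
  by updr.
- move=> _ gs ag; apply: runs_move; first lia.
  by split=> //; [apply: keep_trans (keep_tmp _ _ _ _) (keep_tmp _ _ _ _) | updr; case: gs].
- move=> _ gs ag; apply: runs_move; first lia.
  by split=> //; [apply: keep_trans (keep_tmp _ _ _ _) (keep_tmp _ _ _ _) | updr; case: gs].
- move=> xd gs ag; apply: runs_move; first lia.
  have [_ e _] := good_var gs xd.
  by split=> //; [apply: keep_trans (keep_tmp _ _ _ _) (keep_tmp _ _ _ _) | updr].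
- move=> /andP[wa wb] gs ag; apply: runs_seq.
  apply: runs_weaken (IHa d r env s r4 wa gs ag) (leqnn _) _ => s1 [k1 m1 r1].
  apply: runs_seq.
  apply: runs_weaken (IHb d r.+1 env s1 _ wb (good_keep r4 k1 gs) _) (leqnn _) _.
  + lia.
  + by rewrite m1.
  move=> s2 [k2 m2 r2]; apply: runs_add; split=> /=.
  + apply: keep_trans k1 _; apply: keep_trans (keep_le k2 (leqnn _) (leqnSn _)) _.
    exact: keep_tmp.
  + by rewrite m2.
  + by rewrite upd_same r2 k2.2 // r1.
- move=> /andP[wa wb] gs ag; apply: runs_seq.
  apply: runs_weaken (IHa d r env s r4 wa gs ag) (leqnn _) _ => s1 [k1 m1 r1].
  apply: runs_seq.
  apply: runs_weaken (IHb d r.+1 env s1 _ wb (good_keep r4 k1 gs) _) (leqnn _) _.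
  + lia.
  + by rewrite m1.
  move=> s2 [k2 m2 r2]; apply: runs_sub; split=> /=.
  + apply: keep_trans k1 _; apply: keep_trans (keep_le k2 (leqnn _) (leqnSn _)) _.
    exact: keep_tmp.
  + by rewrite m2.
  + by rewrite upd_same r2 k2.2 // r1.
- move=> /andP[xd yd] gs ag; have -> : k + 5 = k + 4 + 1 by lia.
  apply: runs_seq.
  apply: runs_weaken (runs_get_addr k r4 xd yd gs) (leqnn _) _ => s1 [k1 m1 r1].
  apply: runs_read; split=> //.
  + by apply: keep_trans k1 _; apply: keep_tmp.
  + have [xn _ _] := good_var gs xd; have [yn _ _] := good_var gs yd.
    by rewrite /= upd_same r1 m1 ag.
- move=> /and3P[wa wb wc] gs ag; apply: runs_seq.
  apply: runs_weaken (IHa d r env s r4 wa gs ag) (leqnn _) _ => s1 [k1 m1 r1].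
  have g1 := good_keep r4 k1 gs; have a1 : agrees (mem s1) T by rewrite m1.
  apply: runs_if; rewrite r1 => h.
  + apply: runs_weaken (IHb d r env s1 r4 wb g1 a1) (leqnn _) _ => s2 [k2 m2 r2].
    by rewrite h; split=> //; [apply: keep_trans k1 k2 | rewrite m2].
  + apply: runs_weaken (IHc d r env s1 r4 wc g1 a1) (leqnn _) _ => s2 [k2 m2 r2].
    by rewrite h; split=> //; [apply: keep_trans k1 k2 | rewrite m2].
- move=> wa gs ag.
  have -> : n * (exp_cost n a + 6) + 6 = 1 + (n * (exp_cost n a + 1 + 5) + 5) by lia.
  apply/runs_seq/runs_const; set s1 := set_reg _ _ _.
  have k1 : keep d r s s1 by apply: keep_tmp.
  pose I i m v := m = mem s /\
    v = \sum_(j < i) eval n K d.+1 T (upd env d j) a.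
  apply: (@runs_weaken _ _ _ _ _ _ (runs_loop (I := I) _ _ _ _) (leqnn _)).
  + by rewrite (k1.2 1) ?(good_n gs) //; lia.
  + lia.
  + by split=> //; rewrite big_ord0 /= upd_same.
  + move=> i s2 li k2 [m2 r2] v1 v3.
    have g2 := good_bind (good_keep r4 (keep_trans k1 k2) gs) li v1 v3.
    apply: runs_seq.
    have r6 : 4 <= r.+2 by lia.
    apply: runs_weaken (IHa d.+1 r.+2 _ s2 r6 wa g2 _) (leqnn _) _.
      by rewrite m2.
    move=> s3 [k3 m3 r3]; apply: runs_add; split.
    * apply: keep_trans (keep_le k3 (leqnn _) _) (keep_tmp _ _ _ _); lia.
    * by rewrite /= upd_other; [have := k3.2 r.+1 (ltnSn _); rewrite mulnS addnC|lia].
    * split; first by rewrite /= m3 m2.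
      by rewrite /= upd_same r3 k3.2 // r2 big_ord_recr.
  + move=> s2 [k2 [m2 r2] _]; split=> //; exact: keep_trans k1 k2.
Qed.

(** Serves an assignment in progress, where the half-overwritten table is not among those read. *)
Lemma eval_ext e d T T' env :
  wf_exp d e -> (forall x, x < d -> env x < n) ->
  (forall k i j, reads k e -> i < n -> j < n -> T k i j = T' k i j) ->
  eval n K d T env e = eval n K d T' env e.
Proof.
elim: e d env =>
    [a|||x|a IHa b IHb|a IHa b IHb|k x y|a IHa b IHb c IHc|a IHa] d env //=.
- move=> /andP[wa wb] en h; rewrite (IHa d) ?(IHb d) // => k i j rk; apply: h;
  by rewrite rk ?orbT.
- move=> /andP[wa wb] en h; rewrite (IHa d) ?(IHb d) // => k i j rk; apply: h;
  by rewrite rk ?orbT.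
- by move=> /andP[xd yd] en h; apply: h => //; apply: en.
- move=> /and3P[wa wb wc] en h.
  by rewrite (IHa d) ?(IHb d) ?(IHc d) // => k i j rk; apply: h; rewrite rk ?orbT.
- move=> wa en h; apply: eq_bigr => i _; apply: IHa => // x xd.
  have [->|xd'] := eqVneq x d; first by rewrite upd_same.
  by rewrite upd_other; [apply: en; lia | apply/eqP].
Qed.

Lemma comp_cmd_correct c d r env T s :
  4 <= r -> wf_cmd d c -> good d env s -> agrees (mem s) T ->
  runs (comp_cmd d r c) s (cmd_cost n c) (fun s' =>
    keep d r s s' /\ agrees (mem s') (exec n K d env c T)).
Proof.
elim: c d r env T s => [k e|c1 IH1 c2 IH2|c IH] d r env T s r4 /=.
- move=> /andP[we nr] gs ag.
  pose val i j := eval n K d.+2 T (upd (upd env d i) d.+1 j) e.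
  (* During the assignment the memory is a hybrid: cells of table [k] already visited, in
     lexicographic order, hold new values and all others the old ones. *)
  pose I i (m : nat -> nat) (v : nat) := agrees m (fun k' a b =>
    if (k' == k) && (a < i) then val a b else T k' a b).
  pose J i j (m : nat -> nat) (v : nat) := agrees m (fun k' a b =>
    if (k' == k) && ((a < i) || (a == i) && (b < j)) then val a b else T k' a b).
  have -> : n * (n * (exp_cost n e + (k + 10)) + 10) + 5 =
    n * (n * (exp_cost n e + (k + 4 + 1) + 5) + 5 + 5) + 5 by lia.
  apply: (@runs_weaken _ _ _ _ _ _ (runs_loop (I := I) _ _ _ _) (leqnn _)).
  + exact: good_n gs.
  + lia.
  + by move=> k' a b la lb; rewrite andbF; apply: ag.
  + move=> i s1 li k1 I1 v1 v3.
    have g1 := good_bind (good_keep r4 k1 gs) li v1 v3.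
    apply: (@runs_weaken _ _ _ _ _ _ (runs_loop (I := J i) _ _ _ _) (leqnn _)).
    * exact: good_n g1.
    * lia.
    * move=> k' a b la lb; rewrite (I1 k' a b la lb); congr (if _ then _ else _).
      by rewrite andbF orbF.
    * move=> j s2 lj k2 J2 w1 w3.
      have r6 : 4 <= r.+2 by lia.
      have g2 := good_bind (good_keep r6 k2 g1) lj w1 w3.
      apply: runs_seq.
      have r8 : 4 <= r + 4 by lia.
      apply: runs_weaken (comp_exp_correct r8 we g2 J2) (leqnn _) _.
      move=> s3 [k3 m3 e3]; apply: runs_seq.
      have r10 : 4 <= r + 5 by lia.
      have g3 := good_keep r8 k3 g2.
      apply: runs_weaken
        (@runs_get_addr d.+2 _ (r + 5) k d d.+1 s3 r10 _ _ g3) (leqnn _) _ => //.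
      move=> s4 [k4 m4 e4]; apply: runs_write.
      have k34 : keep d.+2 (r + 4) s2 s4.
        apply: keep_trans k3 (keep_le k4 _ _); lia.
      split.
      - by apply: keep_le k34 _ _; lia.
      - have := k34.2 (r + 3); rewrite (_ : 2 * (r + 3) = 2 * r.+2 + 2); last lia.
        by apply; lia.
      - rewrite /= e4 k4.2; last lia.
        rewrite e3 m4 m3.
        have -> : upd (upd env d i) d.+1 j d = i by rewrite upd_other ?upd_same //; lia.
        rewrite upd_same => k' a b la lb.
        have -> : eval n K d.+2 (fun k' a b =>
          if (k' == k) && ((a < i) || (a == i) && (b < j)) then val a b
          else T k' a b) (upd (upd env d i) d.+1 j) e = val i j.
          apply: eval_ext => // [x xd|k1' i1 j1 rk _ _].
            by have [] := good_var g2 xd.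
          by case: eqP rk nr => // -> ->.
        have [ab|ab] := boolP [&& k' == k, a == i & b == j].
          have [/eqP-> /eqP-> /eqP->] := and3P ab.
          by rewrite upd_same !eqxx ltnn ltnS leqnn.
        rewrite upd_other => [|ee]; last first.
          by have [ek ea eb] := addr_inj la lb li lj ee; rewrite ek ea eb !eqxx in ab.
        rewrite (J2 k' a b la lb); move: ab; rewrite ltnS (leq_eqVlt b).
        by case: (k' == k) (a == i) (b == j) => [] [] [].
    * move=> s2 [k2 J2 _]; split; first by apply: keep_le k2 _ _; lia.
        by have := k2.2 r.+1; rewrite (_ : 2 * r.+1 = 2 * r + 2); [apply|lia].
      move=> k' a b la lb; rewrite (J2 k' a b la lb) lb andbT ltnS (leq_eqVlt a).
      by rewrite orbC.
  + move=> s1 [k1 I1 _]; split=> // k' a b la lb.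
    by rewrite (I1 k' a b la lb) la andbT.
- move=> /andP[w1 w2] gs ag; apply: runs_seq.
  apply: runs_weaken (IH1 d r env T s r4 w1 gs ag) (leqnn _) _ => s1 [k1 a1].
  apply: runs_weaken (IH2 d r env _ s1 r4 w2 (good_keep r4 k1 gs) a1) (leqnn _) _.
  by move=> s2 [k2 a2]; split=> //; apply: keep_trans k1 k2.
- move=> wc gs ag.
  pose I i (m : nat -> nat) (v : nat) :=
    agrees m (iteri i (fun i => exec n K d.+1 (upd env d i) c) T).
  apply: (@runs_weaken _ _ _ _ _ _ (runs_loop (I := I) _ _ _ _) (leqnn _)).
  + exact: good_n gs.
  + lia.
  + exact: ag.
  + move=> i s1 li k1 I1 v1 v3.
    have g1 := good_bind (good_keep r4 k1 gs) li v1 v3.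
    have r6 : 4 <= r.+2 by lia.
    apply: runs_weaken (IH d.+1 r.+2 _ _ s1 r6 wc g1 I1) (leqnn _) _ => s2 [k2 a2].
    split=> //; first by apply: keep_le k2 _ _; lia.
    by have := k2.2 r.+1; rewrite (_ : 2 * r.+1 = 2 * r + 2); [apply|lia].
  + by move=> s1 [k1 I1 _].
Qed.

End Correctness.

(** * Polynomial bounds on the running time *)

Definition poly_bounded (f : nat -> nat) : Prop :=
  exists a e, forall n, f n <= a * n.+1 ^ e.

Lemma poly_bounded_cst a : poly_bounded (fun=> a).
Proof. by exists a, 0 => n; rewrite expn0 muln1. Qed.

Lemma poly_bounded_id : poly_bounded id.
Proof. by exists 1, 1 => n; rewrite expn1 mul1n. Qed.

Lemma poly_bounded_add f g :
  poly_bounded f -> poly_bounded g -> poly_bounded (fun n => f n + g n).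
Proof.
move=> [a [d fa]] [b [e gb]]; exists (a + b), (d + e) => n.
rewrite mulnDl; apply: leq_add; [apply: leq_trans (fa n) _|apply: leq_trans (gb n) _];
  by rewrite leq_mul2l leq_pexp2l ?orbT // ?leq_addr ?leq_addl.
Qed.

Lemma poly_bounded_mul f g :
  poly_bounded f -> poly_bounded g -> poly_bounded (fun n => f n * g n).
Proof.
move=> [a [d fa]] [b [e gb]]; exists (a * b), (d + e) => n.
by rewrite expnD mulnACA leq_mul.
Qed.

Lemma exp_cost_poly e : poly_bounded (fun n => exp_cost n e).
Proof.
have S f : poly_bounded f -> poly_bounded (fun n => (f n).+1).
  by move=> /(poly_bounded_add (poly_bounded_cst 1)).
elim: e => /=; by eauto 8 using poly_bounded_cst, poly_bounded_id,
  poly_bounded_add, poly_bounded_mul.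
Qed.

Lemma cmd_cost_poly c : poly_bounded (fun n => cmd_cost n c).
Proof.
have h := exp_cost_poly.
elim: c => /=; by eauto 10 using poly_bounded_cst, poly_bounded_id,
  poly_bounded_add, poly_bounded_mul.
Qed.

(** * The kernel as a table program *)

Section Encoding.

Lemma nth_allpairs (A B C : Type) (f : A -> B -> C) (s : seq A) (t : seq B)
    a0 b0 c0 i j :
  i < size s -> j < size t ->
  nth c0 [seq f a b | a <- s, b <- t] (i * size t + j) = f (nth a0 s i) (nth b0 t j).
Proof.
move=> + jt; elim: s i => //= a s IH [_|i] /=.
  by rewrite nth_cat size_map mul0n jt (nth_map b0).
rewrite ltnS => is_; rewrite nth_cat size_map mulSn -addnA ltnNge leq_addr /=.
by rewrite addKn IH.
Qed.

Variable x : instance.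
Let n := order x.

Lemma size_encode : size (encode x) = n * n + 2.
Proof. by rewrite /= size_allpairs size_enum_ord addn2. Qed.

Lemma nth_encode_adj (i j : 'I_n) :
  nth 0 (encode x) (2 + i * n + j) = adj (graph x) i j.
Proof.
have := @nth_allpairs _ _ _ (fun u v => adj (graph x) u v : nat) (enum 'I_n)
  (enum 'I_n) i j 0 i j.
rewrite size_enum_ord -addnA !nth_ord_enum => h.
exact: h (ltn_ord i) (ltn_ord j).
Qed.

(** The word has [n * n + 2] entries of at least one digit each. So powers of [n.+1] are bounded by
    powers of the input size. *)
Lemma bit_size_encode : n < bit_size (encode x).
Proof.
have : size (encode x) <= bit_size (encode x).
  by rewrite /bit_size -sum1_size; apply: leq_sum.
by rewrite size_encode; apply: leq_trans; nia.
Qed.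

End Encoding.

(** The empty loop only serves to leave [n * n] in register 3. The three expressions end up in
    registers 8, 10 and 12 and become the order, the budget and the length of the output word. *)
Definition table_machine (c : cmd) (en ek el : exp) : ram :=
  Seq (Const 8 0) (Seq (Read 2 8) (Seq (Const 8 1) (Seq (Read 6 8)
  (Seq (loop 0 4 Skip) (Seq (move 4 3)
  (Seq (comp_cmd 0 4 c)
  (Seq (comp_exp 0 4 en) (Seq (comp_exp 0 5 ek) (Seq (comp_exp 0 6 el)
  (Seq (move 0 12)
  (Seq (Const 14 0) (Seq (Write 14 8) (Seq (Const 14 1) (Write 14 10)))))))))))))).

Definition input_tables (x : instance) : tables :=
  fun k i j => nth 0 (encode x) (addr (order x) k i j).

Definition output_tables (c : cmd) (x : instance) : tables :=
  exec (order x) (budget x) 0 (fun=> 0) c (input_tables x).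

Definition output_value (c : cmd) (e : exp) (x : instance) : nat :=
  eval (order x) (budget x) 0 (output_tables c x) (fun=> 0) e.

Lemma table_machine_correct c en ek el :
  wf_cmd 0 c -> wf_exp 0 en -> wf_exp 0 ek -> wf_exp 0 el ->
  exists a d, forall x, exists t s,
    [/\ ram_exec (table_machine c en ek el) (ram_input (encode x)) t s,
        t <= a * bit_size (encode x) ^ d,
        [/\ reg s 0 = output_value c el x, mem s 0 = output_value c en x
          & mem s 1 = output_value c ek x]
      & forall i j, i < order x -> j < order x ->
          mem s (2 + i * order x + j) = output_tables c x 0 i j].
Proof.
move=> wc wn wk wl.
pose cost n := 4 + (n * 6 + 5) + 2 + cmd_cost n c + (exp_cost n en +
  (exp_cost n ek + (exp_cost n el + 6))).
have [a [d costP]] : poly_bounded cost.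
  have h := exp_cost_poly; have h' := cmd_cost_poly.
  by rewrite /cost; eauto 20 using poly_bounded_cst, poly_bounded_id,
    poly_bounded_add, poly_bounded_mul.
exists a, d => x; set n := order x; set K := budget x.
suff [t [s [e le [h1 h2]]]] : runs (table_machine c en ek el) (ram_input (encode x))
    (cost n) (fun s => [/\ reg s 0 = output_value c el x,
      mem s 0 = output_value c en x & mem s 1 = output_value c ek x] /\
      forall i j, i < n -> j < n -> mem s (2 + i * n + j) = output_tables c x 0 i j).
  exists t, s; split=> //; apply: leq_trans le _; apply: leq_trans (costP n) _.
  rewrite leq_mul2l; apply/orP; right; case: (d) => [|e']; first by rewrite !expn0.
  by rewrite leq_exp2r ?bit_size_encode.
have -> : cost n = 1 + (1 + (1 + (1 + ((n * (1 + 5) + 5) + (2 + (cmd_cost n c +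
    (exp_cost n en + (exp_cost n ek + (exp_cost n el + (2 + (1 + (1 + (1 + 1))))))))))))).
  by rewrite /cost; lia.
apply/runs_seq/runs_const/runs_seq/runs_read/runs_seq/runs_const/runs_seq/runs_read.
apply: runs_seq; set s0 := set_reg _ 6 _.
have s02 : reg s0 2 = n by [].
have s06 : reg s0 6 = K by [].
have m0 : mem s0 = nth 0 (encode x) by [].
move: s0 s02 s06 m0 => s0 s02 s06 m0.
have run1 := @runs_loop n 0 4 Skip 1 (fun _ m _ => m = mem s0) s0 s02.
apply: (@runs_weaken _ _ _ _ _ _ (run1 _ _ _) (leqnn _)) => //.
  by move=> i s li k1 ms _ _; apply: runs_skip; split.
move=> s1 [k1 m1 r1]; apply: runs_seq; apply: runs_move => //.
set s2 := set_reg _ 4 _.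
have g2 : good n K 0 (fun=> 0) s2.
  split=> //; rewrite /s2 /=.
  - by rewrite /upd /= (k1.2 1).
  - by rewrite /upd /= (k1.2 3).
have a2 : agrees n (mem s2) (input_tables x) by rewrite /s2 /= m1 m0.
move: s2 g2 a2 => s2 g2 a2 {s1 k1 m1 r1}.
apply: runs_seq.
apply: (runs_weaken (comp_cmd_correct (r := 4) _ wc g2 a2) (leqnn _)) => //.
move=> s3 [k3 a3]; have g3 := good_keep (leqnn 4) k3 g2.
apply: runs_seq.
apply: (runs_weaken (comp_exp_correct (r := 4) _ wn g3 a3) (leqnn _)) => //.
move=> s4 [k4 m4 r4]; have g4 := good_keep (leqnn 4) k4 g3; rewrite -m4 in a3.
apply: runs_seq.
apply: (runs_weaken (comp_exp_correct (r := 5) _ wk g4 a3) (leqnn _)) => //.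
move=> s5 [k5 m5 r5]; have g5 := good_keep (leqnSn 4) k5 g4; rewrite -m5 in a3.
apply: runs_seq.
apply: (runs_weaken (comp_exp_correct (r := 6) _ wl g5 a3) (leqnn _)) => //.
move=> s6 [k6 m6 r6]; rewrite -m6 in a3.
apply: runs_seq; apply: runs_move => //.
apply/runs_seq/runs_const/runs_seq/runs_write/runs_seq/runs_const/runs_write.
rewrite /= /upd /=; split.
  split; first exact: r6.
    exact: etrans (k6.2 4 isT) (etrans (k5.2 4 isT) r4).
  exact: etrans (k6.2 5 isT) r5.
by move=> i j li lj; apply: etrans (a3 0 i j li lj); rewrite /addr mul0n addn0 -!addnA.
Qed.

(** * Derived operators, with truth values 0 and 1 *)

Definition Lt (a b : exp) : exp := Cond (Minus b a) (Num 1) (Num 0).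
Definition And (a b : exp) : exp := Cond a (Cond b (Num 1) (Num 0)) (Num 0).
Definition Or (a b : exp) : exp := Cond a (Num 1) (Cond b (Num 1) (Num 0)).
Definition Not (a : exp) : exp := Cond a (Num 0) (Num 1).
Definition Eq (a b : exp) : exp := Not (Or (Lt a b) (Lt b a)).
Definition Ex (a : exp) : exp := Cond (Sum a) (Num 1) (Num 0).

Section EvalMacros.

Variables (n K d : nat) (T : tables) (env : nat -> nat).
Notation ev := (eval n K d T env).

Lemma ev_Lt a b : ev (Lt a b) = (ev a < ev b).
Proof. by rewrite /= subn_eq0 -ltnNge; case: ltnP. Qed.

Lemma ev_And a b : ev (And a b) = (ev a != 0) && (ev b != 0).
Proof. by rewrite /=; case: (ev a != 0) (ev b != 0) => [] []. Qed.

Lemma ev_Or a b : ev (Or a b) = (ev a != 0) || (ev b != 0).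
Proof. by rewrite /=; case: (ev a != 0) (ev b != 0) => [] []. Qed.

Lemma ev_Not a : ev (Not a) = (ev a == 0).
Proof. by rewrite /=; case: (ev a == 0). Qed.

Lemma ev_Eq a b : ev (Eq a b) = (ev a == ev b).
Proof. by rewrite ev_Not ev_Or !ev_Lt; case: ltngtP. Qed.

Lemma ev_Ex a :
  ev (Ex a) = [exists i : 'I_n, eval n K d.+1 T (upd env d i) a != 0].
Proof.
rewrite /= sum_nat_eq0 negb_forall.
by under eq_existsb do rewrite implyTb; case: [exists _, _].
Qed.

Lemma ev_Sum a : ev (Sum a) = \sum_(i < n) eval n K d.+1 T (upd env d i) a.
Proof. by []. Qed.

Lemma ev_Num a : ev (Num a) = a.
Proof. by []. Qed.

Lemma ev_Bound : ev Bound = n.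
Proof. by []. Qed.

Lemma ev_Budget : ev Budget = K.
Proof. by []. Qed.

Lemma ev_Var x : ev (Var x) = env x.
Proof. by []. Qed.

Lemma ev_Plus a b : ev (Plus a b) = ev a + ev b.
Proof. by []. Qed.

Lemma ev_Minus a b : ev (Minus a b) = ev a - ev b.
Proof. by []. Qed.

Lemma ev_Get k x y : ev (Get k x y) = T k (env x) (env y).
Proof. by []. Qed.

Lemma ev_Cond a b c : ev (Cond a b c) = if ev a != 0 then ev b else ev c.
Proof. by []. Qed.

End EvalMacros.

Lemma nat_of_bool_neq0 (b : bool) : ((b : nat) != 0) = b.
Proof. by case: b. Qed.

Definition evE := (ev_Lt, ev_And, ev_Or, ev_Not, ev_Eq, ev_Ex, ev_Num, ev_Bound,
  ev_Budget, ev_Var, ev_Plus, ev_Minus, ev_Get, ev_Cond, nat_of_bool_neq0).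

(** This is how the language multiplies: a loop over the vertices adds [c] in its first [m] rounds,
    whence [m <= n]. *)
Lemma sum_below n m c : m <= n -> \sum_(i < n) (if i < m then c else 0) = m * c.
Proof.
move=> mn; rewrite -big_mkcond /= -(big_ord_widen n (fun=> c) mn).
by rewrite sum_nat_const card_ord.
Qed.

Lemma iteri_foldl n (A : Type) (F : nat -> A -> A) a :
  iteri n F a = foldl (fun a (i : 'I_n) => F i a) a (enum 'I_n).
Proof.
have -> : forall s a, foldl (fun a (i : 'I_n) => F i a) a s =
    foldl (fun a i => F i a) a (map val s) by elim=> //= i s IH.
rewrite val_enum_ord.
by elim: n => // n IH; rewrite -[in RHS]addn1 iotaD foldl_cat -IH.
Qed.

Lemma foldl_rel (A B C : Type) (R : A -> B -> Prop) (F : A -> C -> A)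
    (F' : B -> C -> B) (s : seq C) a b :
  (forall a b c, R a b -> R (F a c) (F' b c)) -> R a b ->
  R (foldl F a s) (foldl F' b s).
Proof. by move=> h; elim: s a b => //= c s IH a b ab; apply/IH/h. Qed.

(** * The kernel in the table language *)

Definition par_exp : exp := Minus Bound Budget.

Definition par2_exp (d : nat) : exp :=
  Sum (Cond (Lt (Var d) par_exp) par_exp (Num 0)).

Definition par4_exp (d : nat) : exp :=
  Sum (Cond (Lt (Var d) par_exp)
    (Sum (Cond (Lt (Var d.+1) par_exp) (par2_exp d.+2) (Num 0))) (Num 0)).

Definition times4 (e : exp) : exp := Plus (Plus e e) (Plus e e).

Definition deg_exp (d k x : nat) : exp := Sum (Get k x d).

Definition arcs_exp (d k : nat) : exp := Sum (deg_exp d.+1 k d).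

Definition step_exp : exp :=
  Or (Get 1 2 3)
    (And (Or (And (Eq (Var 2) (Var 0)) (Eq (Var 3) (Var 1)))
             (And (Eq (Var 2) (Var 1)) (Eq (Var 3) (Var 0))))
    (And (Get 0 0 1)
    (And (Lt (deg_exp 4 1 0) (times4 (par2_exp 4)))
    (And (Lt (deg_exp 4 1 1) (times4 (par2_exp 4)))
         (Lt (arcs_exp 4 1) (times4 (times4 (par4_exp 4)))))))).

Definition kept_exp : exp :=
  Or (deg_exp 2 1 0)
    (Or (Lt (Var 0) par_exp)
      (And (Not (deg_exp 2 0 0))
        (Lt (Sum (And (Not (deg_exp 3 0 2)) (Lt (Var 2) (Var 0)))) par_exp))).

Definition merged_exp : exp :=
  Cond (Get 3 0 0) (Eq (Var 1) (Var 0))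
    (Cond (Ex (And (Get 3 2 2) (Get 0 0 2)))
      (And (Get 3 1 1) (And (Get 0 0 1)
        (Not (Ex (And (Lt (Var 2) (Var 1)) (And (Get 3 2 2) (Get 0 0 2)))))))
      (Eq (Var 1) (Num 0))).

Definition merged_adj_exp : exp :=
  And (Not (Eq (Var 0) (Var 1)))
    (Ex (Ex (And (Get 4 2 0) (And (Get 4 3 1) (Get 0 2 3))))).

Definition rank_exp (d x : nat) : exp := Sum (And (Get 3 d d) (Lt (Var d) (Var x))).

Definition card_exp (d : nat) : exp := Sum (Get 3 d d).

(* The kernel occupies the first cells of table 0, row by row with rows of the
   length of the kernel. *)
Definition output_exp : exp :=
  Sum (Sum (Cond (And (Get 3 2 2) (And (Get 3 3 3)
      (Eq (Plus (Sum (Cond (Lt (Var 4) (rank_exp 5 2)) (card_exp 5) (Num 0)))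
                (rank_exp 4 3))
          (Plus (Sum (Cond (Lt (Var 4) (Var 0)) Bound (Num 0))) (Var 1)))))
    (Get 5 2 3) (Num 0))).

Definition length_exp : exp :=
  Plus (Sum (Cond (Lt (Var 0) (card_exp 1)) (card_exp 1) (Num 0))) (Num 2).

(* Tables: 0 the input graph, 1 [sparse], 2 a copy of it being updated,
   3 [kept] (constant along rows), 4 [merged], 5 [merged_adj]. *)
Definition kernel_cmd : cmd :=
  Then (SetT 1 (Num 0))
  (Then (For (For (Then (SetT 2 step_exp) (SetT 1 (Get 2 2 3)))))
  (Then (SetT 3 kept_exp)
  (Then (SetT 4 merged_exp)
  (Then (SetT 5 merged_adj_exp)
        (SetT 0 output_exp))))).

(** * Correctness of the kernel program *)

Section KernelProgram.

Variables (n K : nat) (G : sgraph 'I_n).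
Let p := n - K.

Definition holds (T : tables) (k : nat) (R : rel 'I_n) : Prop :=
  forall i j : 'I_n, T k i j = R i j.

Lemma exec_Then d env c1 c2 T :
  exec n K d env (Then c1 c2) T = exec n K d env c2 (exec n K d env c1 T).
Proof. by []. Qed.

Lemma exec_For d env c T : exec n K d env (For c) T =
  foldl (fun T (i : 'I_n) => exec n K d.+1 (upd env d i) c T) T (enum 'I_n).
Proof. exact: iteri_foldl. Qed.

Lemma holds_set d env k e T (R : rel 'I_n) :
  (forall i j : 'I_n, eval n K d.+2 T (upd (upd env d i) d.+1 j) e = R i j) ->
  holds (exec n K d env (SetT k e) T) k R.
Proof. by move=> h i j; rewrite /= eqxx h. Qed.

Lemma holds_other d env k e T k' R :
  k' != k -> holds T k' R -> holds (exec n K d env (SetT k e) T) k' R.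
Proof. by move=> /negbTE kk' h i j; rewrite /= kk' h. Qed.

Lemma ev_par2 d T env : eval n K d T env (par2_exp d) = p * p.
Proof.
rewrite ev_Sum -(sum_below p (leq_subr K n)); apply: eq_bigr => i _.
by rewrite !evE upd_same.
Qed.

Lemma ev_par4 d T env : eval n K d T env (par4_exp d) = p * (p * (p * p)).
Proof.
rewrite ev_Sum -(sum_below (p * (p * p)) (leq_subr K n)); apply: eq_bigr => i _.
rewrite !evE upd_same; congr (if _ then _ else _).
rewrite ev_Sum -(sum_below (p * p) (leq_subr K n)); apply: eq_bigr => j _.
by rewrite !evE ev_par2 upd_same.
Qed.

Lemma ev_deg d T (env : nat -> nat) k x R (u : 'I_n) :
  holds T k R -> x != d -> env x = u -> eval n K d T env (deg_exp d k x) = deg R u.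
Proof.
move=> h xd eu; apply: eq_bigr => v _ /=; rewrite upd_same upd_other; last exact/eqP.
by rewrite eu h.
Qed.

Lemma ev_arcs d T env k R : holds T k R -> eval n K d T env (arcs_exp d k) = arcs R.
Proof.
move=> h; rewrite ev_Sum; apply: eq_bigr => u _.
apply: (ev_deg (u := u) h); last by rewrite upd_same.
by rewrite neq_ltn ltnSn.
Qed.

Lemma ev_step T H (u v i j : 'I_n) env :
  holds T 0 (adj G) -> holds T 1 H ->
  eval n K 4 T (upd (upd (upd (upd env 0 u) 1 v) 2 i) 3 j) step_exp =
  greedy_step p G u H v i j.
Proof.
move=> h0 h1; have e4 m : m + m + (m + m) = 4 * m by lia.
rewrite /step_exp !evE !ev_par2 !ev_par4 !e4.
rewrite (ev_deg (u := u) h1) // (ev_deg (u := v) h1) // (ev_arcs _ _ h1).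
rewrite /upd /= h0 h1 !nat_of_bool_neq0.
by rewrite /greedy_step /deg_cap /arc_cap -[16]/(4 * 4) -[4 * 4 * _]mulnA.
Qed.

(** The two loops simulate the two folds of [sparse] step by step; table 2 is a buffer, as table 1
    may not be read while it is assigned. *)
Lemma holds_sparse T : holds T 0 (adj G) ->
  let T' := exec n K 0 (fun=> 0)
    (Then (SetT 1 (Num 0)) (For (For (Then (SetT 2 step_exp) (SetT 1 (Get 2 2 3)))))) T in
  holds T' 0 (adj G) /\ holds T' 1 (sparse p G).
Proof.
move=> h0; rewrite exec_Then exec_For.
apply: (foldl_rel (R := fun T H => holds T 0 (adj G) /\ holds T 1 H)); last first.
  by split; [apply: holds_other | apply: holds_set].
move=> {h0}T H u h; rewrite exec_For.
apply: (foldl_rel (R := fun T H => holds T 0 (adj G) /\ holds T 1 H)) => //.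
move=> {h}T {}H v [h0 h1]; rewrite exec_Then; split.
  by do 2! apply: holds_other => //.
have h2 : holds (exec n K 2 (upd (upd (fun=> 0) 0 u) 1 v) (SetT 2 step_exp) T) 2
    (greedy_step p G u H v) by apply: holds_set => i j; apply: ev_step.
by apply: holds_set => i j; rewrite ev_Get; apply: h2.
Qed.

Lemma ev_kept T (i j : 'I_n) env :
  holds T 0 (adj G) -> holds T 1 (sparse p G) ->
  eval n K 2 T (upd (upd env 0 i) 1 j) kept_exp = kept p G i.
Proof.
move=> h0 h1; rewrite /kept_exp !evE.
rewrite (ev_deg (u := i) h1) // (ev_deg (u := i) h0) // ev_Sum.
rewrite upd_other // upd_same /kept lt0n.
congr (nat_of_bool (_ || (_ || (_ && (_ < _))))).
by apply: eq_bigr => y _; rewrite !evE (ev_deg (u := y) h0).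
Qed.

Lemma ev_merged T (i j : 'I_n) env :
  holds T 0 (adj G) -> holds T 3 (fun x _ => kept p G x) ->
  eval n K 2 T (upd (upd env 0 i) 1 j) merged_exp = merged p G i j.
Proof.
move=> h0 h3; rewrite /merged_exp !evE.
have -> : [exists z : 'I_n, eval n K 3 T (upd (upd (upd env 0 i) 1 j) 2 z)
    (And (Get 3 2 2) (Get 0 0 2)) != 0] = [exists z, kept p G z && adj G i z].
  by apply: eq_existsb => z; rewrite !evE /upd /= h0 h3 !nat_of_bool_neq0.
have -> : [exists z : 'I_n, eval n K 3 T (upd (upd (upd env 0 i) 1 j) 2 z)
    (And (Lt (Var 2) (Var 1)) (And (Get 3 2 2) (Get 0 0 2))) != 0] =
    [exists z : 'I_n, [&& z < j, kept p G z & adj G i z]].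
  by apply: eq_existsb => z; rewrite !evE /upd /= h0 h3 !nat_of_bool_neq0.
rewrite /upd /= h0 !h3 !nat_of_bool_neq0 /merged /has_kept_nbr.
by case: kept => //; case: existsP => // _; rewrite eqb0.
Qed.

Lemma ev_merged_adj T (i j : 'I_n) env :
  holds T 0 (adj G) -> holds T 4 (merged p G) ->
  eval n K 2 T (upd (upd env 0 i) 1 j) merged_adj_exp = merged_adj p G i j.
Proof.
move=> h0 h4; rewrite /merged_adj_exp !evE /merged_adj; congr (nat_of_bool (_ && _)).
  by rewrite /upd /= eqb0.
apply: eq_existsb => x; rewrite !evE; apply: eq_existsb => y.
by rewrite !evE /upd /= h0 !h4 !nat_of_bool_neq0.
Qed.

Lemma ev_rank d T (env : nat -> nat) x (u : 'I_n) :
  holds T 3 (fun x _ => kept p G x) -> x != d -> env x = u ->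
  eval n K d T env (rank_exp d x) = rank (kept p G) u.
Proof.
move=> h3 xd eu; rewrite ev_Sum; apply: eq_bigr => y _.
rewrite !evE upd_same upd_other; last exact/eqP.
by rewrite eu h3 nat_of_bool_neq0.
Qed.

Lemma ev_card d T env : holds T 3 (fun x _ => kept p G x) ->
  eval n K d T env (card_exp d) = #|kept p G|.
Proof.
by move=> h3; rewrite -sum_pred ev_Sum; apply: eq_bigr => y _; rewrite !evE upd_same h3.
Qed.

Lemma card_kept_le : #|kept p G| <= n.
Proof. by rewrite -[X in _ <= X]card_ord; apply: max_card. Qed.

Lemma ev_length T env : holds T 3 (fun x _ => kept p G x) ->
  eval n K 0 T env length_exp = #|kept p G| * #|kept p G| + 2.
Proof.
move=> h3; rewrite /length_exp !evE ev_Sum -(sum_below _ card_kept_le).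
by congr (_ + _); apply: eq_bigr => i _; rewrite !evE !(ev_card _ _ h3) upd_same.
Qed.

(** The same memory position is cell [(i, j)] in rows of length [n] and cell [(a, b)] in rows of the
    length of the kernel. Division recovers the ranks from the position, so only one term of the
    double sum over pairs of vertices survives. *)
Lemma ev_output T (i j : 'I_n) env (a b : 'I_#|kept p G|) :
  holds T 3 (fun x _ => kept p G x) -> holds T 5 (merged_adj p G) ->
  i * n + j = a * #|kept p G| + b ->
  eval n K 2 T (upd (upd env 0 i) 1 j) output_exp = adj (kernel p G) a b.
Proof.
move=> h3 h5 eij.
set m := #|kept p G| in a b eij *.
have rank_pair (u v : 'I_n) : kept p G u -> kept p G v ->
    (rank (kept p G) u * m + rank (kept p G) v == i * n + j) =
    ((u == kernel_emb a) && (v == kernel_emb b)).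
  move=> ku kv; rewrite eij.
  apply/eqP/andP => [e|[/eqP-> /eqP->]]; last by rewrite !kernel_emb_rank.
  have m0 : 0 < m by apply: leq_ltn_trans (ltn_ord a).
  have lv : rank (kept p G) v < m by apply: rank_lt_card.
  have eu : rank (kept p G) u = a.
    by have /(congr1 (divn^~ m)) := e; rewrite !divnMDl // !divn_small ?addn0.
  have ev : rank (kept p G) v = b by rewrite eu in e; apply: addnI e.
  by split; apply/eqP; apply: (@rank_inj n (kept p G)) => //;
    rewrite ?kernel_emb_rank //; apply: kernel_emb_kept.
rewrite /output_exp ev_Sum.
transitivity (\sum_(u < n) \sum_(v < n)
    if (u == kernel_emb a) && (v == kernel_emb b) then merged_adj p G u v : nat else 0).
  apply: eq_bigr => u _; rewrite ev_Sum; apply: eq_bigr => v _.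
  rewrite ev_Cond !ev_And !nat_of_bool_neq0 ev_Eq nat_of_bool_neq0.
  rewrite !ev_Plus !ev_Get ev_Var (ev_rank (u := v) h3) //.
  have -> : eval n K 4 T (upd (upd (upd (upd env 0 i) 1 j) 2 u) 3 v)
      (Sum (Cond (Lt (Var 4) (rank_exp 5 2)) (card_exp 5) (Num 0))) =
      rank (kept p G) u * m.
    have rn : rank (kept p G) u <= n.
      by rewrite -[X in _ <= X]card_ord -sum1_card; apply: leq_sum => y _; case: (_ && _).
    rewrite ev_Sum -(sum_below _ rn).
    by apply: eq_bigr => z _; rewrite !evE (ev_card _ _ h3) (ev_rank (u := u) h3).
  have -> : eval n K 4 T (upd (upd (upd (upd env 0 i) 1 j) 2 u) 3 v)
      (Sum (Cond (Lt (Var 4) (Var 0)) Bound (Num 0))) = i * n.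
    by rewrite ev_Sum -(sum_below _ (ltnW (ltn_ord i))); apply: eq_bigr => z _; rewrite !evE.
  rewrite /upd /= !h3 h5 !nat_of_bool_neq0.
  have [ku|nku] := boolP (kept p G u); last first.
    by have [e|//] := eqVneq u (kernel_emb a); rewrite e kernel_emb_kept in nku.
  have [kv|nkv] := boolP (kept p G v); last first.
    have [e|_] := eqVneq v (kernel_emb b); last by rewrite andbF.
    by rewrite e kernel_emb_kept in nkv.
  by rewrite rank_pair.
rewrite (bigD1 (kernel_emb a)) //= (bigD1 (kernel_emb b)) //= !eqxx.
rewrite big1 => [|v /negbTE->]; last by rewrite andbF.
rewrite big1 => [|u /negbTE->]; last by rewrite big1.
by rewrite !addn0.
Qed.

Lemma kernel_cmd_correct T0 : holds T0 0 (adj G) ->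
  let T := exec n K 0 (fun=> 0) kernel_cmd T0 in
  holds T 3 (fun x _ => kept p G x) /\
  forall (i j : 'I_n) (a b : 'I_#|kept p G|),
    i * n + j = a * #|kept p G| + b -> T 0 i j = adj (kernel p G) a b.
Proof.
move=> h; rewrite /kernel_cmd !exec_Then.
have := holds_sparse h; rewrite exec_Then; set T1 := exec _ _ _ _ (For _) _ => -[h0 h1].
set T3 := exec _ _ _ _ (SetT 3 _) _.
have k0 : holds T3 0 (adj G) by apply: holds_other.
have k3 : holds T3 3 (fun x _ => kept p G x).
  by apply: holds_set => i j; apply: ev_kept.
set T4 := exec _ _ _ _ (SetT 4 _) _.
have l0 : holds T4 0 (adj G) by apply: holds_other.
have l3 : holds T4 3 (fun x _ => kept p G x) by apply: holds_other.
have l4 : holds T4 4 (merged p G) by apply: holds_set => i j; apply: ev_merged.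
set T5 := exec _ _ _ _ (SetT 5 _) _.
have q3 : holds T5 3 (fun x _ => kept p G x) by apply: holds_other.
have q5 : holds T5 5 (merged_adj p G).
  by apply: holds_set => i j; apply: ev_merged_adj.
split=> [|i j a b e]; first exact: holds_other.
exact: (ev_output (fun=> 0) q3 q5 e).
Qed.

End KernelProgram.

(** * The kernelization and its bounds *)

Definition kernelize (x : instance) : instance :=
  let p := order x - budget x in
  Instance (kernel p (graph x)) (#|kept p (graph x)| - p).

Lemma kernelize_poly_time : poly_time kernelize.
Proof.
have [a [d h]] := @table_machine_correct kernel_cmd (card_exp 0)
  (Minus (card_exp 0) par_exp) length_exp isT isT isT isT.
exists (table_machine kernel_cmd (card_exp 0) (Minus (card_exp 0) par_exp) length_exp), a, d.
move=> x; have [t [s [e le [s0 m0 m1] mij]]] := h x; exists t, s; split=> //.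
set n := order x in mij *; set K := budget x; set p := n - K.
set G := graph x; set N := #|kept p G|.
set T := output_tables kernel_cmd x.
have h0 : holds (input_tables x) 0 (adj G).
  by move=> i j; rewrite /input_tables /addr mul0n addn0 nth_encode_adj.
have [h3 hout] : holds T 3 (fun x _ => kept p G x) /\
    forall (i j : 'I_n) (a b : 'I_N),
      i * n + j = a * N + b -> T 0 i j = adj (kernel p G) a b
  := kernel_cmd_correct K h0.
have NE : output_value kernel_cmd (card_exp 0) x = N by apply: ev_card.
split; first by rewrite size_encode s0; apply: ev_length.
case=> [_|[_|q]].
- by rewrite m0.
- by rewrite m1 -[LHS]/(output_value kernel_cmd (card_exp 0) x - p) NE.
rewrite size_encode addn2 !ltnS => lt.
have qN : q < N * N := lt.
have N_le : N <= n := card_kept_le K G.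
have N0 : 0 < N by rewrite lt0n; apply: contraTneq qN => ->.
have n0 : 0 < n by apply: leq_trans N_le.
have qn : q < n * n by apply: leq_trans qN _; apply: leq_mul.
(* Position [q] is split into row and column twice: by [N] for the kernel and by [n] for the
   table. *)
have la : q %/ N < N by rewrite ltn_divLR.
have lb : q %% N < N by rewrite ltn_mod.
have li : q %/ n < n by rewrite ltn_divLR.
have lj : q %% n < n by rewrite ltn_mod.
have := nth_encode_adj (x := kernelize x) (Ordinal la) (Ordinal lb).
rewrite -addnA /= -divn_eq => ->.
have e_pos : q %/ n * n + q %% n = q %/ N * N + q %% N by rewrite -!divn_eq.
rewrite -(hout (Ordinal li) (Ordinal lj) (Ordinal la) (Ordinal lb) e_pos).
by have := mij _ _ li lj; rewrite -addnA -divn_eq.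
Qed.

(** If the budget is at least the order, then [p = 0] and the new budget is the whole order of the
    kernel, so both sides hold. Otherwise both budgets leave [p] parts, as [N - (N - p) = p]. *)
Lemma kernelize_target b x :
  identifiable (target b) (budget x) (graph x) <->
  identifiable (target b) (budget (kernelize x)) (graph (kernelize x)).
Proof.
rewrite /=; set p := order x - budget x; set N := #|_|.
have [le|lt] := leqP (order x) (budget x).
  have p0 : p = 0 by apply/eqP; rewrite subn_eq0.
  by split=> _; apply: identifiable_large_budget; rewrite card_ord // p0 subn0.
have pn : 0 < p <= order x by rewrite subn_gt0 lt leq_subr.
have pN : p <= N by apply: kept_card_ge; rewrite leq_subr.
rewrite !identifiable_solvable ?card_ord ?subKn //; first exact: kernel_solvable.
by have /andP[p0 _] := pn; lia.
Qed.

Lemma kernelize_admits_kernel b :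
  admits_kernel (fun x => identifiable (target b) (budget x) (graph x))
    order_minus_budget (fun p => p ^ 4).
Proof.
exists kernelize; split.
- exact: kernelize_poly_time.
- exact: kernelize_target.
(* The order is at most [16 * p ^ 4 + 1 + 2 * p] with [p <= p ^ 4]. Truncation makes [p] zero when
   the budget exceeds the order, so only [p <= q] holds. *)
- exists 19 => x; set q := `|_|%N; rewrite /=; set p := order x - budget x.
  have pq : p <= q by rewrite /p /q /order_minus_budget; lia.
  apply: leq_trans (kept_card_le _ _) _.
  have le4 : p ^ 4 <= q ^ 4 by rewrite leq_exp2r.
  have -> : arc_cap p = 16 * p ^ 4 by rewrite /arc_cap !expnS expn0 muln1.
  have : p <= p ^ 4 by case: (p) => // m; rewrite expnS leq_pmulr // expn_gt0.
  lia.
- exists (fun z => `|z|%N) => x; rewrite /order_minus_budget /=.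
  set p := order x - budget x; set N := #|_|.
  have pN : p <= N by apply: kept_card_ge; rewrite leq_subr.
  by rewrite /p in pN *; lia.
Qed.

Theorem theorem4p6 :
  admits_kernel clique_identification order_minus_budget (fun p => p ^ 4) /\
  admits_kernel cluster_identification order_minus_budget (fun p => p ^ 4).
Proof.
split; [exact: (kernelize_admits_kernel true) | exact: (kernelize_admits_kernel false)].
Qed.
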